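(* Let $K$ be a field and let $G$ be a finite simple graph without isolated vertices. If $G$ is bipartite, then $\operatorname{reg} I(X_G)=\mu(G)$, where $\mu(G)$ is the maximum vertex join number of $G$.
   Context: Graphs have nonempty vertex set. For a graph $G$ with vertex set $V_G$ and edge set $E_G$, let $K[V_G]=K[x_i: i\in V_G]$ and $K[E_G]=K[t_e: e\in E_G]$ be standard graded polynomial rings, and let $\theta\colon K[E_G]\to K[V_G]$ be the $K$-algebra homomorphism with $\theta(t_e)=x_ix_j$ for each edge $e=\{i,j\}$. The ideal $I(X_G)\subseteq K[E_G]$ is the (homogeneous) ideal $I(X_G)=\theta^{-1}\big((x_i^2-x_j^2 : i,j\in V_G)\big)$. The Castelnuovo--Mumford regularity of a finitely generated graded module $M$ over a polynomial ring is $\operatorname{reg} M=\max\{j-i : \beta_{ij}\neq 0\}$, where $\beta_{ij}$ are the graded Betti numbers of $M$; for ideals, $\operatorname{reg} I(X_G)=\operatorname{reg} K[E_G]/I(X_G)+1$ (in particular $\operatorname{reg} I(X_G)=1$ when $I(X_G)=(0)$). A circuit is a closed trail (edges are not repeated, vertices may be), with edge set $E_C$. A join of $G$ is a set $J\subseteq E_G$ such that $|J\cap E_C|\leq |E_C|/2$ for every circuit $C$ in $G$. The maximum vertex join number $\mu(G)$ is the maximum cardinality of a join of $G$. *)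

(* Defs.v *)
From HB Require Import structures.
From mathcomp Require Import all_boot all_order all_algebra.
From mathcomp Require Import mpoly.

Set Implicit Arguments.
Unset Strict Implicit.
Unset Printing Implicit Defensive.

Import Order.TTheory GRing.Theory Num.Theory.

Local Open Scope ring_scope.

(** * Finite simple graphs *)

Record sgraph := SGraph {
  vertex :> finType;
  adj : rel vertex;
  adj_sym : ssrbool.symmetric adj;
  adj_irrefl : irreflexive adj
}.

Definition edges (G : sgraph) : {set {set G}} :=
  [set [set p.1; p.2] | p : G * G & adj p.1 p.2].

Definition no_isolated_vertices (G : sgraph) : Prop :=
  forall x : G, exists y : G, adj x y.

Definition bipartite (G : sgraph) : Prop :=
  exists A : {set G}, forall x y : G, adj x y -> (x \in A) != (y \in A).

(** * Circuits and joins *)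

(* The walk x :: p is represented by its first vertex x and the sequence p of
   the following ones, as in [path]. *)
Definition walk_edges (G : sgraph) (x : G) (p : seq G) : seq {set G} :=
  pairmap (fun u v => [set u; v]) x p.

Definition circuit (G : sgraph) (x : G) (p : seq G) : bool :=
  [&& path (@adj G) x p, last x p == x & uniq (walk_edges x p)].

Definition circuit_edges (G : sgraph) (x : G) (p : seq G) : {set {set G}} :=
  [set e in walk_edges x p].

(* A circuit does not repeat edges, so it has at most #|edges G| of them: the
   bound on the length of p, which makes this a boolean predicate, is not a
   restriction (see [is_joinP]). *)
Definition is_join (G : sgraph) (J : {set {set G}}) : bool :=
  (J \subset edges G) &&
  [forall x : G, forall p : {bseq #|edges G| of G}, circuit x p ==>
     ((#|J :&: circuit_edges x p|).*2 <= #|circuit_edges x p|)%N].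

Definition max_vertex_join_number (G : sgraph) : nat :=
  (\max_(J : {set {set G}} | is_join J) #|J|)%N.

Lemma walk_edges_sub (G : sgraph) (x : G) (p : seq G) :
  path (@adj G) x p -> {subset walk_edges x p <= edges G}.
Proof.
elim: p x => [|y p IHp] x //= /andP[xy py] e; rewrite inE.
case/predU1P => [-> | /(IHp _ py) //].
by apply/imsetP; exists (x, y); rewrite ?inE.
Qed.

Lemma circuit_size (G : sgraph) (x : G) (p : seq G) :
  circuit x p -> (size p <= #|edges G|)%N.
Proof.
case/and3P => xp _ Up; rewrite -(size_pairmap (fun u v => [set u; v]) x p).
rewrite cardE; apply: uniq_leq_size => // e /(walk_edges_sub xp).
by rewrite mem_enum.
Qed.

Lemma is_joinP (G : sgraph) (J : {set {set G}}) :
  reflect (J \subset edges G /\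
           forall (x : G) (p : seq G), circuit x p ->
             ((#|J :&: circuit_edges x p|).*2 <= #|circuit_edges x p|)%N)
          (is_join J).
Proof.
apply: (iffP andP) => [] [sJ H]; split=> //.
  move=> x p Cp; move/forallP/(_ x)/forallP/(_ (Bseq (circuit_size Cp))): H.
  by move/implyP; apply.
by apply/forallP => x; apply/forallP => p; apply/implyP; apply: H.
Qed.

(** * The ideal I(X_G) *)

Definition ideal_span (R : comNzRingType) (I : finType) (g : I -> R) (p : R) :
    Prop :=
  exists c : I -> R, p = \sum_i c i * g i.

(* K[V_G] and K[E_G]: the variables are numbered by the canonical enumerations
   [enum_rank] of the vertices and [enum_val] of the edges. *)

Definition xvar (K : fieldType) (G : sgraph) (v : G) : {mpoly K[#|G|]} :=
  'X_(enum_rank v).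

Definition theta (K : fieldType) (G : sgraph) (p : {mpoly K[#|edges G|]}) :
    {mpoly K[#|G|]} :=
  p \mPo [tuple \prod_(v in enum_val k) xvar K v | k < #|edges G|].

Definition IX (K : fieldType) (G : sgraph) (p : {mpoly K[#|edges G|]}) : Prop :=
  ideal_span (fun ij : G * G => xvar K ij.1 ^+ 2 - xvar K ij.2 ^+ 2) (theta p).

(** * Graded Betti numbers and regularity of S/I *)

Section Regularity.
Variables (K : fieldType) (n : nat).
Local Notation S := {mpoly K[n]}.

(* A complex  ... -> F_2 -> F_1 -> F_0 -> S  of graded free modules
   F_i = \bigoplus_k S(- deg i k), with k < rk i.  Elements of F_i are row
   vectors, [diff i] is the matrix of F_{i+1} -> F_i and [aug] that of
   F_0 -> S, both acting by right multiplication. *)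
Record free_complex := FreeComplex {
  rk : nat -> nat;
  deg : forall i, 'I_(rk i) -> nat;
  diff : forall i, 'M[S]_(rk i.+1, rk i);
  aug : 'cV[S]_(rk 0)
}.

(* [p] is homogeneous of degree [b - a] in Z; so p = 0 if b < a. *)
Definition homog_of_shift (a b : nat) (p : S) : Prop :=
  {in msupp p, forall m, (mdeg m + a)%N = b}.

(* F, with the augmentation composed with S -> S/I, is a minimal graded free
   resolution of S/I: all maps have degree 0, the augmented complex
   ... -> F_1 -> F_0 -> S/I -> 0 is exact, and F_{i+1} is mapped into
   (t_1, ..., t_n) F_i. *)
Definition minimal_free_resolution (I : S -> Prop) (F : free_complex) : Prop :=
  [/\ (forall k, homog_of_shift 0 (deg k) (aug F k ord0))
      /\ (forall i k l, homog_of_shift (deg l) (deg k) (diff F i k l)),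
      forall f : S, exists u : 'rV[S]_(rk F 0),
        I (f - (u *m aug F) ord0 ord0),
      forall u : 'rV[S]_(rk F 0),
        I ((u *m aug F) ord0 ord0) <->
        exists w : 'rV[S]_(rk F 1), u = w *m diff F 0,
      forall i (u : 'rV[S]_(rk F i.+1)),
        u *m diff F i = 0 <->
        exists w : 'rV[S]_(rk F i.+2), u = w *m diff F i.+1
    & forall i k l, (diff F i k l)@_0%MM = 0].

(* When F is a minimal graded free resolution of M, this is beta_{ij}(M). *)
Definition betti (F : free_complex) (i j : nat) : nat :=
  #|[set k : 'I_(rk F i) | deg k == j]|.

(* reg (S/I) = r.  Minimal graded free resolutions being unique up to
   isomorphism, the Betti numbers may be read off from any of them. *)
Definition quotient_regularity (I : S -> Prop) (r : int) : Prop :=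
  (exists F, minimal_free_resolution I F) /\
  (forall F, minimal_free_resolution I F ->
    (exists i j, betti F i j != 0%N /\ r = j%:Z - i%:Z) /\
    (forall i j, betti F i j != 0%N -> j%:Z - i%:Z <= r)).

(* reg I = r, through the convention reg I = reg (S/I) + 1, also for I = 0. *)
Definition ideal_regularity (I : S -> Prop) (r : int) : Prop :=
  exists2 q : int, quotient_regularity I q & r = q + 1.

End Regularity.

(* Main.v *)
(* If y is a nonzerodivisor on S/I and M = S/(I, y) has top degree r, then
   reg S/I = r.  For a resolution F of S/I and variables s = (y, x_1, ..., x_k),
   the sequences 0 -> F/(s)F -> F/(s)F -> F/(s, x)F -> 0 (multiplication by x)
   show, by induction on k from H_*(F/yF) = M, that H_i(F/(s)F) vanishes in
   degrees > i + r and that H_k(F/(s)F) is nonzero in degree k + r; with all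
   variables in s, and F minimal, H_i(F/(s)F) is the K-space of Betti numbers.
   The same bounds give a finite minimal resolution step by step.

   For bipartite G every variable t_e is a nonzerodivisor on S/I(X_G), and two
   monomials of S are congruent modulo I(X_G) iff they have the same degree and
   the same set of vertices of odd degree, their boundary.  If m(b) is the least
   degree of a monomial with boundary b, a monomial of degree d and boundary a is
   nonzero modulo t_e iff d = m(a) < m(a + e).  By the parity imposed by
   bipartiteness m(a + e) = m(a) +- 1, so the top degree of S/(I(X_G), t_e) is
   (max m) - 1.  Finally max m = mu(G): decomposing an even edge set into
   circuits, the joins are the smallest edge sets with a given boundary. *)

Require Import Defs.
From mathcomp Require Import all_boot all_order all_algebra.
From mathcomp Require Import mpoly.
From Stdlib Require Import Classical ClassicalEpsilon.
From mathcomp Require Import zify.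

Set Implicit Arguments.
Unset Strict Implicit.
Unset Printing Implicit Defensive.

Import Order.TTheory GRing.Theory Num.Theory.
Local Open Scope ring_scope.

(** * Graded polynomials and ideals of variables *)

Section HomogeneousParts.
Variables (K : fieldType) (n : nat).
Local Notation S := {mpoly K[n]}.

Definition mpart (P : pred 'X_{1..n}) (p : S) : S :=
  \sum_(m <- msupp p | P m) p@_m *: 'X_[m].

Lemma mcoeff_mpart P p m : (mpart P p)@_m = if P m then p@_m else 0.
Proof.
rewrite /mpart raddf_sum /=.
under eq_bigr do rewrite mcoeffZ mcoeffX.
have [ms|ms] := boolP (m \in msupp p); last first.
  rewrite (memN_msupp_eq0 ms) if_same big_seq_cond big1 // => m' /andP[m's _].
  by case: eqP => [e|_]; [move: ms; rewrite -e m's | rewrite mulr0].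
case: ifP => Pm; last first.
  rewrite big1 // => m' Pm'; case: eqP => [e|_]; last by rewrite mulr0.
  by move: Pm'; rewrite e Pm.
rewrite big_mkcond (bigD1_seq m) ?msupp_uniq //= Pm eqxx mulr1 big1 ?addr0 //.
by move=> m' /negPf ->; rewrite mulr0 if_same.
Qed.

Lemma mcoeffXM (i : 'I_n) (p : S) m : ('X_i * p)@_(U_(i) + m) = p@_m.
Proof. by rewrite mulrC mcoeffMX. Qed.

Lemma mcoeffXM0 (i : 'I_n) (p : S) (m : 'X_{1..n}) :
  m i = 0%N -> ('X_i * p)@_m = 0.
Proof.
move=> mi; apply/eqP; rewrite mcoeff_eq0 mulrC (perm_mem (msuppMX p U_(i))).
apply/mapP => -[m' _ e]; by move: mi; rewrite e mnmDE mnm1E eqxx.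
Qed.

Lemma mpoly_divX (i : 'I_n) (p : S) :
  (forall m : 'X_{1..n}, m i = 0%N -> p@_m = 0) -> exists q, p = 'X_i * q.
Proof.
move=> H; exists (\sum_(m <- msupp p) p@_m *: 'X_[m - U_(i)]).
rewrite mulr_sumr [LHS]mpolyE; apply: eq_big_seq => m.
rewrite mcoeff_msupp => pm; rewrite -scalerAr -mpolyXD addmC submK //.
apply/mnm_lepP => j; rewrite mnm1E; case: eqP => [<-|//].
by rewrite lt0n; apply: contraNneq pm => /H ->.
Qed.

(** The degree is counted on a generator of degree [d]; adding [d] instead of subtracting it makes
    the part zero when [j < d]. *)
Definition hpart (d j : nat) : S -> S := mpart (fun m => mdeg m + d == j)%N.

Lemma mcoeff_hpart d j p m :
  (hpart d j p)@_m = if (mdeg m + d == j)%N then p@_m else 0.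
Proof. exact: mcoeff_mpart. Qed.

Lemma hpartD d j p q : hpart d j (p + q) = hpart d j p + hpart d j q.
Proof.
apply/mpolyP => m; rewrite mcoeffD !mcoeff_hpart mcoeffD.
by case: ifP; rewrite ?addr0.
Qed.

Lemma hpart0 d j : hpart d j 0 = 0.
Proof. by apply/mpolyP => m; rewrite mcoeff_hpart mcoeff0 if_same. Qed.

Lemma hpart_sum d j I (r : seq I) P F :
  hpart d j (\sum_(i <- r | P i) F i) = \sum_(i <- r | P i) hpart d j (F i).
Proof. exact: (big_morph _ (@hpartD d j) (hpart0 d j)). Qed.

Lemma hpartM a b j p q : homog_of_shift a b q ->
  hpart a j (p * q) = hpart b j p * q.
Proof.
move=> hq; apply/mpolyP => m; rewrite mcoeff_hpart !mcoeffM.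
have [e|e] := boolP (_ == j).
  apply: eq_bigr => -[m1 m2] /= /eqP em; rewrite mcoeff_hpart.
  have [ms|ms] := boolP (val m2 \in msupp q); last first.
    by rewrite (memN_msupp_eq0 ms) !mulr0.
  have := congr1 (@mdeg n) em; rewrite mdegD => ed.
  by rewrite -(hq _ ms) addnA -ed e.
rewrite big1 // => -[m1 m2] /= /eqP em; rewrite mcoeff_hpart.
case: ifP => [/eqP e1|_]; last by rewrite mul0r.
have [ms|ms] := boolP (val m2 \in msupp q); last first.
  by rewrite (memN_msupp_eq0 ms) mulr0.
have := congr1 (@mdeg n) em; rewrite mdegD => ed.
by case/negP: e; rewrite ed -addnA (hq _ ms) e1 eqxx.
Qed.

Lemma hpartX d j (i : 'I_n) p : hpart d j.+1 ('X_i * p) = 'X_i * hpart d j p.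
Proof.
rewrite mulrC [RHS]mulrC [hpart d j p]/hpart.
have hX : homog_of_shift d d.+1 ('X_i : S).
  by move=> m; rewrite msuppX inE => /eqP ->; rewrite mdeg1.
rewrite (hpartM _ _ hX); congr (_ * _); apply/mpolyP => m.
by rewrite !mcoeff_mpart addnS eqSS.
Qed.

Lemma hpartX0 d (i : 'I_n) p : hpart d 0 ('X_i * p) = 0.
Proof.
apply/mpolyP => m; rewrite mcoeff_hpart mcoeff0; case: ifP => //.
rewrite addn_eq0 mdeg_eq0 => /andP[/eqP -> _].
by rewrite mcoeffXM0 // mnm0E.
Qed.

(** The ideal generated by the variables in [s]. It is a monomial ideal, so membership only asks
    that monomials free of [s] have coefficient zero. *)
Definition in_vars (s : seq 'I_n) (p : S) : Prop :=
  forall m : 'X_{1..n}, (forall i, i \in s -> m i = 0%N) -> p@_m = 0.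

Lemma in_varsD s p q : in_vars s p -> in_vars s q -> in_vars s (p + q).
Proof. by move=> hp hq m hm; rewrite mcoeffD hp ?hq ?addr0. Qed.

Lemma in_vars0 s : in_vars s 0.
Proof. by move=> m _; rewrite mcoeff0. Qed.

Lemma in_varsMl s p q : in_vars s q -> in_vars s (p * q).
Proof.
move=> hq m hm; rewrite mcoeffM big1 // => -[m1 m2] /= /eqP em.
rewrite hq ?mulr0 // => i /hm mi; have := congr1 (fun z : 'X_{1..n} => z i) em.
by rewrite mi mnmDE => /esym/eqP; rewrite addn_eq0 => /andP[_ /eqP].
Qed.

Lemma in_varsX s i p : i \in s -> in_vars s ('X_i * p).
Proof. by move=> si m hm; apply: mcoeffXM0; apply: hm. Qed.

(** Multiplying by ['X_i] keeps a monomial free of [s], so ['X_i] is a nonzerodivisor modulo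
    [(s)]. *)
Lemma in_varsX_inv s i p : i \notin s -> in_vars s ('X_i * p) -> in_vars s p.
Proof.
move=> si hp m hm; rewrite -(mcoeffXM i); apply: hp => j js.
by rewrite mnmDE mnm1E hm // addn0; case: eqP si => // ->; rewrite js.
Qed.

Lemma in_vars_sub s t p : {subset s <= t} -> in_vars s p -> in_vars t p.
Proof. by move=> st hp m hm; apply: hp => i /st; apply: hm. Qed.

Lemma in_vars_hpart d j s p : in_vars s p -> in_vars s (hpart d j p).
Proof. by move=> hp m hm; rewrite mcoeff_hpart hp ?if_same. Qed.

Lemma in_vars_cons i s p : in_vars (i :: s) p ->
  exists a b, in_vars s a /\ p = 'X_i * b + a.
Proof.
(* [a] collects the monomials of [p] without ['X_i]; each of them contains a variable of [s]. *)
move=> hp; set a := mpart (fun m : 'X_{1..n} => m i == 0%N) p.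
have [|b eb] := @mpoly_divX i (p - a).
  by move=> m mi; rewrite mcoeffB mcoeff_mpart mi eqxx subrr.
exists a, b; split; last by rewrite -eb subrK.
move=> m hm; rewrite mcoeff_mpart; case: ifP => // /eqP mi.
by apply: hp => j; rewrite inE => /predU1P[-> //|]; apply: hm.
Qed.

End HomogeneousParts.

(** * Joins as minimal edge sets with given odd vertices *)

Section Joins.
Local Open Scope nat_scope.

Definition symdiff (T : finType) (A B : {set T}) := (A :\: B) :|: (B :\: A).

Lemma card_symdiff (T : finType) (A B : {set T}) :
  #|symdiff A B| + (#|A :&: B|).*2 = #|A| + #|B|.
Proof.
rewrite /symdiff cardsU; have -> : (A :\: B) :&: (B :\: A) = set0.
  by apply/setP => x; rewrite !inE; case: (x \in A); case: (x \in B).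
rewrite cards0 -(cardsID B A) -(cardsID A B) (setIC B A); lia.
Qed.

Variable G : sgraph.
Implicit Types (J D C : {set {set G}}) (x y z v w : G) (p : seq G).

Definition incident v J := [set e in J | v \in e].

Definition odd_vertices J : {set G} := [set v | odd #|incident v J|].

Lemma incident_symdiff v J D :
  incident v (symdiff J D) = symdiff (incident v J) (incident v D).
Proof.
apply/setP => e; rewrite !inE.
by case: (e \in J); case: (e \in D); case: (v \in e).
Qed.

Lemma odd_symdiff (T : finType) (A B : {set T}) :
  odd #|symdiff A B| = odd #|A| (+) odd #|B|.
Proof. by rewrite -oddD -card_symdiff oddD odd_double addbF. Qed.

Lemma odd_vertices_symdiff J D v :
  (v \in odd_vertices (symdiff J D)) =
    (v \in odd_vertices J) (+) (v \in odd_vertices D).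
Proof. by rewrite !inE incident_symdiff odd_symdiff. Qed.

(** The boundary modulo 2 telescopes along a walk to its two ends; the ends of a single edge differ
    by irreflexivity. *)
Lemma walk_parity x p v : path (@adj G) x p ->
  odd (count (fun e : {set G} => v \in e) (walk_edges x p)) =
    (v == x) (+) (v == last x p).
Proof.
elim: p x => [|y p IHp] x /=; first by rewrite addbb.
case/andP=> xy yp; rewrite oddD IHp // !inE.
have : (v == x) && (v == y) = false.
  by apply/andP => -[/eqP vx /eqP vy]; rewrite -vx -vy adj_irrefl in xy.
by case: (v == x); case: (v == y); case: (v == last y p).
Qed.

Lemma incident_walk x p v : uniq (walk_edges x p) ->
  #|incident v (circuit_edges x p)| =
    count (fun e : {set G} => v \in e) (walk_edges x p).
Proof.
move=> U; rewrite -size_filter -(card_uniqP _) ?filter_uniq //.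
by apply: eq_card => e; rewrite !inE mem_filter andbC.
Qed.

Lemma circuit_odd_vertices x p : circuit x p ->
  odd_vertices (circuit_edges x p) = set0.
Proof.
case/and3P => xp /eqP lx U; apply/setP => v.
by rewrite !inE incident_walk // walk_parity // lx addbb.
Qed.

Lemma circuit_edges_sub x p : circuit x p -> circuit_edges x p \subset edges G.
Proof.
by case/and3P => xp _ _; apply/subsetP => e; rewrite inE; apply: walk_edges_sub.
Qed.

Lemma edge_at e v : e \in edges G -> v \in e ->
  exists2 w, adj v w & e = [set v; w].
Proof.
case/imsetP => -[a b] /=; rewrite inE /= => ab ->; rewrite !inE.
by case/orP => /eqP ->; [exists b | exists a; [rewrite adj_sym | rewrite setUC]].
Qed.

(* A longest trail inside D is closed: at its last vertex, if different from
   the first, it uses an odd number of the evenly many edges of D. *)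
Lemma trail_extend D x p : D \subset edges G -> odd_vertices D = set0 ->
  p != [::] -> path (@adj G) x p -> uniq (walk_edges x p) ->
  {subset walk_edges x p <= D} ->
  exists p', [/\ circuit x p', p' != [::] & circuit_edges x p' \subset D].
Proof.
move=> DE D0; have [k] := ubnP (#|D| - size p); elim: k p => // k IHk p.
rewrite ltnS => pk p0 xp U pD.
have [lx|lx] := eqVneq (last x p) x.
  exists p; split=> //; first by rewrite /circuit xp lx eqxx.
  by apply/subsetP => e; rewrite inE; apply: pD.
have sCD : incident (last x p) (circuit_edges x p) \subset incident (last x p) D.
  by apply/subsetP => e; rewrite !inE => /andP[/pD -> ->].
have /subsetPn[e] : ~~ (incident (last x p) D \subset
                        incident (last x p) (circuit_edges x p)).
  apply/negP => sDC; have /setP/(_ (last x p)) := D0.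
  rewrite !inE.
  have -> : incident (last x p) D = incident (last x p) (circuit_edges x p).
    by apply/eqP; rewrite eqEsubset sCD sDC.
  by rewrite incident_walk // walk_parity // eqxx (negPf lx).
rewrite !inE => /andP[eD ze]; rewrite ze andbT => eNp.
have [w zw ew] := edge_at (subsetP DE _ eD) ze.
have we : walk_edges x (rcons p w) = rcons (walk_edges x p) e.
  by rewrite /walk_edges -cats1 pairmap_cat /= -ew cats1.
have sz : size (walk_edges x (rcons p w)) <= #|D|.
  rewrite cardE; apply: uniq_leq_size; first by rewrite we rcons_uniq eNp.
  move=> f; rewrite we mem_rcons inE mem_enum.
  by case/predU1P => [-> //|/pD].
apply: (IHk (rcons p w)).
- by move: sz; rewrite /walk_edges size_pairmap !size_rcons; lia.
- by case: (p).
- by rewrite rcons_path xp.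
- by rewrite we rcons_uniq eNp.
by move=> f; rewrite we mem_rcons inE => /predU1P[-> //|/pD].
Qed.

Lemma even_has_circuit D : D \subset edges G -> odd_vertices D = set0 ->
  D != set0 -> exists x p,
    [/\ circuit x p, p != [::] & circuit_edges x p \subset D].
Proof.
move=> DE D0 /set0Pn[e eD].
have /imsetP[[x w] /=] := subsetP DE _ eD; rewrite inE /= => xw ew.
exists x; apply: (@trail_extend D x [:: w]) => //=; first by rewrite xw.
by move=> f; rewrite inE -ew => /eqP ->.
Qed.

(** Circuits are peeled off [D] one at a time: the rest stays even, and the inequalities defining a
    join add up. *)
Lemma join_even J D : is_join J -> D \subset edges G -> odd_vertices D = set0 ->
  (#|J :&: D|).*2 <= #|D|.
Proof.
case/is_joinP => _ Jc; have [k] := ubnP #|D|; elim: k D => // k IHk D.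
rewrite ltnS => Dk DE D0.
have [->|Dn] := eqVneq D set0; first by rewrite setI0 cards0.
have [x [p [Cp p0 CD]]] := even_has_circuit DE D0 Dn.
set C := circuit_edges x p in CD.
have C0 : 0 < #|C|.
  apply/card_gt0P; case: p p0 @C {Cp CD} => // w p _; exists [set x; w].
  by rewrite inE mem_head.
have eD : symdiff D C = D :\: C.
  rewrite /symdiff; have /eqP -> : C :\: D == set0 by rewrite setD_eq0.
  by rewrite setU0.
have cDC := cardsID C D; rewrite (setIidPr CD) in cDC.
have DC0 : odd_vertices (D :\: C) = set0.
  rewrite -eD; apply/setP => v.
  by rewrite odd_vertices_symdiff D0 (circuit_odd_vertices Cp) !inE.
have := IHk (D :\: C) _ (subset_trans (subsetDl _ _) DE) DC0.
have -> : #|D :\: C| < k by lia.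
move=> /(_ isT).
have := Jc x p Cp; rewrite -/C.
have -> : J :&: (D :\: C) = (J :&: D) :\: C by rewrite setIDA.
have := cardsID C (J :&: D); rewrite -setIA (setIidPr CD); lia.
Qed.

(** The symmetric difference is even, so [join_even] bounds twice [#|J :\: J'|] by
    [#|J :\: J'| + #|J' :\: J|]. *)
Lemma join_le J J' : is_join J -> J' \subset edges G ->
  odd_vertices J = odd_vertices J' -> #|J| <= #|J'|.
Proof.
move=> hJ J'E e; have JE : J \subset edges G by case/is_joinP: hJ.
have DE : symdiff J J' \subset edges G.
  by rewrite subUset !(subset_trans (subsetDl _ _)).
have D0 : odd_vertices (symdiff J J') = set0.
  by apply/setP => v; rewrite odd_vertices_symdiff e addbb inE.
have := join_even hJ DE D0; have := card_symdiff J J'.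
have -> : J :&: symdiff J J' = J :\: J'.
  by apply/setP => f; rewrite !inE; case: (f \in J); case: (f \in J').
have := cardsID J' J; lia.
Qed.

(** Exchanging edges along a circuit [C] keeps the odd vertices, so minimality forces [#|J|] to be
    at most [#|J| + #|C| - 2 #|J :&: C|]. *)
Lemma min_is_join J : J \subset edges G ->
  (forall J', J' \subset edges G -> odd_vertices J' = odd_vertices J ->
     #|J| <= #|J'|) -> is_join J.
Proof.
move=> JE Jmin; apply/is_joinP; split=> // x p Cp.
have CE := circuit_edges_sub Cp.
have := card_symdiff J (circuit_edges x p).
suff : #|J| <= #|symdiff J (circuit_edges x p)| by lia.
apply: Jmin; first by rewrite subUset !(subset_trans (subsetDl _ _)).
by apply/setP => v; rewrite odd_vertices_symdiff (circuit_odd_vertices Cp) !inE addbF.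
Qed.

(** * Boundaries of monomials in the edge variables *)

Local Notation mon := 'X_{1..#|edges G|}.

Definition mon_of J : mon :=
  [multinom (enum_val k \in J : nat) | k < #|edges G|].

Definition odd_part (m : mon) : {set {set G}} :=
  [set enum_val k | k : 'I_#|edges G| & odd (m k)].

(** These are the vertices whose variable has odd exponent in the image of the monomial under
    [theta]. *)
Definition boundary (m : mon) : {set G} :=
  [set v | odd (\sum_(k < #|edges G|) (v \in enum_val k) * m k)].

Lemma boundaryD (m1 m2 : mon) v :
  (v \in boundary (m1 + m2)) = (v \in boundary m1) (+) (v \in boundary m2).
Proof.
rewrite !inE -oddD -big_split; congr odd; apply: eq_bigr => k _ /=.
by rewrite mnmDE mulnDr.
Qed.

Lemma mdeg_mon_of J : J \subset edges G -> mdeg (mon_of J) = #|J|.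
Proof.
move=> JE; rewrite mdegE.
transitivity (\sum_(e in edges G) (e \in J : nat)).
  by rewrite [RHS]big_enum_val; apply: eq_bigr => k _; rewrite mnmE.
rewrite -big_mkcondr sum1dep_card; apply: eq_card => e; rewrite !inE.
by rewrite andb_idl //; apply: (subsetP JE).
Qed.

Lemma boundary_mon_of J : J \subset edges G ->
  boundary (mon_of J) = odd_vertices J.
Proof.
move=> JE; apply/setP => v; rewrite !inE; congr odd.
transitivity (\sum_(e in edges G) ((v \in e) && (e \in J) : nat)).
  rewrite [RHS]big_enum_val; apply: eq_bigr => k _; rewrite mnmE.
  by case: (v \in _); rewrite ?mul1n ?mul0n.
rewrite -big_mkcondr sum1dep_card; apply: eq_card => e; rewrite !inE.
by case: (boolP (e \in J)) => [/(subsetP JE) ->|_]; rewrite ?andbT ?andbF.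
Qed.

Lemma odd_part_sub (m : mon) : odd_part m \subset edges G.
Proof. by apply/subsetP => e /imsetP[k _ ->]; apply: enum_valP. Qed.

Lemma mon_of_odd_part (m : mon) k : mon_of (odd_part m) k = odd (m k).
Proof.
rewrite mnmE; congr nat_of_bool; apply/imsetP/idP => [[k']|mk].
  by rewrite inE => mk /enum_val_inj ->.
by exists k; rewrite ?inE.
Qed.

Lemma card_odd_part (m : mon) : #|odd_part m| <= mdeg m.
Proof.
rewrite -(mdeg_mon_of (odd_part_sub m)) !mdegE; apply: leq_sum => k _.
by rewrite mon_of_odd_part; case: (m k) => // j; case: (odd _).
Qed.

Lemma odd_vertices_odd_part (m : mon) : odd_vertices (odd_part m) = boundary m.
Proof.
rewrite -(boundary_mon_of (odd_part_sub m)); apply/setP => v; rewrite !inE.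
rewrite !(big_morph odd oddD (erefl _)); apply: eq_bigr => k _.
by rewrite !oddM mon_of_odd_part !oddb.
Qed.

(** A smallest edge set with the given odd vertices is a join; its squarefree monomial serves as
    [m']. *)
Lemma boundary_short (m : mon) : exists2 m' : mon,
  boundary m' = boundary m & mdeg m' <= max_vertex_join_number G.
Proof.
pose P J := (J \subset edges G) && (odd_vertices J == boundary m).
have P0 : P (odd_part m) by rewrite /P odd_part_sub odd_vertices_odd_part /=.
have [J /andP[JE /eqP Jm] Jmin] := arg_minnP (fun J => #|J|) P0.
exists (mon_of J); first by rewrite boundary_mon_of.
rewrite mdeg_mon_of // /max_vertex_join_number.
apply: (@leq_bigmax_cond _ _ (fun J => #|J|)).
apply: min_is_join => // J' J'E eJ'; apply: Jmin.
by rewrite /P J'E eJ' Jm /=.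
Qed.

(** The witness is the squarefree monomial of a maximum join. A competitor is first stripped of its
    squares, then compared by [join_le]. *)
Lemma boundary_long : exists2 m : mon, mdeg m = max_vertex_join_number G &
  forall m' : mon, boundary m' = boundary m -> mdeg m <= mdeg m'.
Proof.
have J0 : is_join (set0 : {set {set G}}).
  by apply/is_joinP; split=> [|x p _]; rewrite ?sub0set // set0I cards0.
have J0' : 0 < #|@is_join G| by apply/card_gt0P; exists set0.
have [J hJ eJ] := eq_bigmax_cond (fun J : {set {set G}} => #|J|) J0'.
have JE : J \subset edges G by case/is_joinP: hJ.
exists (mon_of J); first by rewrite mdeg_mon_of.
move=> m' em; rewrite mdeg_mon_of //; apply: leq_trans (card_odd_part m').
apply: join_le => //; first exact: odd_part_sub.
by rewrite odd_vertices_odd_part em boundary_mon_of.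
Qed.

Lemma boundary_parity (m1 m2 : mon) : bipartite G ->
  boundary m1 = boundary m2 -> odd (mdeg m1) = odd (mdeg m2).
Proof.
case=> A hA e12.
(* Each edge has exactly one end in [A], so the degree is a sum of vertex degrees over [A], whose
   parities the boundary records. *)
have dE (m : mon) :
    mdeg m = \sum_(v in A) \sum_(k < #|edges G|) (v \in enum_val k) * m k.
  rewrite exchange_big mdegE; apply: eq_bigr => k _ /=; rewrite -big_distrl /=.
  suff -> : \sum_(v in A) (v \in enum_val k) = 1 by rewrite mul1n.
  have /imsetP[[a b] /=] := enum_valP k; rewrite inE /= => ab ->.
  rewrite -big_mkcondr sum1dep_card.
  have := hA _ _ ab; case Aa : (a \in A); case Ab : (b \in A) => // _.
    rewrite -(card1 a); apply: eq_card => v; rewrite !inE.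
    have [->|_] := eqVneq v a; first by rewrite Aa.
    by have [->|_] := eqVneq v b; rewrite ?Ab ?andbF.
  rewrite -(card1 b); apply: eq_card => v; rewrite !inE.
  have [->|_] := eqVneq v b; first by rewrite Ab orbT.
  by have [->|_] := eqVneq v a; rewrite ?Aa ?andbF.
rewrite !dE !(big_morph odd oddD (erefl _)); apply: eq_bigr => v _.
by have /setP/(_ v) := e12; rewrite !inE.
Qed.

End Joins.

(** * Graded submodules of free modules *)

Section GradedModules.
Variables (K : fieldType) (n : nat).
Local Notation S := {mpoly K[n]}.

Record submodule m (N : 'rV[S]_m -> Prop) : Prop := Submodule {
  submod0 : N 0;
  submodD : forall u v, N u -> N v -> N (u + v);
  submodZ : forall p u, N u -> N (p *: u)
}.

Lemma submodN m (N : 'rV[S]_m -> Prop) u : submodule N -> N u -> N (- u).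
Proof. by move=> hN Nu; rewrite -scaleN1r; apply: submodZ. Qed.

Lemma submodB m (N : 'rV[S]_m -> Prop) u v :
  submodule N -> N u -> N v -> N (u - v).
Proof. by move=> hN Nu Nv; apply: submodD => //; apply: submodN. Qed.

Lemma submod_sum m (N : 'rV[S]_m -> Prop) I (r : seq I) (P : pred I) F :
  submodule N -> (forall i, P i -> N (F i)) -> N (\sum_(i <- r | P i) F i).
Proof.
by move=> hN hF; apply: big_ind => //; [apply: submod0 | apply: submodD].
Qed.

Definition homog_part m (deg : 'I_m -> nat) j (u : 'rV[S]_m) : 'rV[S]_m :=
  \row_k hpart (deg k) j (u ord0 k).

Definition ishomog m (deg : 'I_m -> nat) j (u : 'rV[S]_m) :=
  homog_part deg j u = u.

Definition graded m (deg : 'I_m -> nat) (N : 'rV[S]_m -> Prop) :=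
  forall j u, N u -> N (homog_part deg j u).

Lemma homog_partD m (deg : 'I_m -> nat) j u v :
  homog_part deg j (u + v) = homog_part deg j u + homog_part deg j v.
Proof. by apply/rowP => k; rewrite !mxE hpartD. Qed.

Lemma homog_partB m (deg : 'I_m -> nat) j u v :
  homog_part deg j (u - v) = homog_part deg j u - homog_part deg j v.
Proof.
apply/rowP => k; rewrite !mxE hpartD; congr (_ + _); apply/mpolyP => m'.
by rewrite mcoeffN !mcoeff_hpart mcoeffN; case: ifP; rewrite ?oppr0.
Qed.

Lemma homog_part0 m (deg : 'I_m -> nat) j : homog_part deg j 0 = 0.
Proof. by apply/rowP => k; rewrite !mxE hpart0. Qed.

Lemma homog_partX m (deg : 'I_m -> nat) j i u :
  homog_part deg j.+1 ('X_i *: u) = 'X_i *: homog_part deg j u.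
Proof. by apply/rowP => k; rewrite !mxE hpartX. Qed.

Lemma homog_partK m (deg : 'I_m -> nat) j u : ishomog deg j (homog_part deg j u).
Proof.
apply/rowP => k; rewrite !mxE; apply/mpolyP => m'.
by rewrite !mcoeff_hpart; case: (_ == j).
Qed.

Lemma homogX m (deg : 'I_m -> nat) j i u :
  ishomog deg j u -> ishomog deg j.+1 ('X_i *: u).
Proof. by rewrite /ishomog homog_partX => ->. Qed.

Lemma homogD m (deg : 'I_m -> nat) j u v :
  ishomog deg j u -> ishomog deg j v -> ishomog deg j (u + v).
Proof. by rewrite /ishomog homog_partD => -> ->. Qed.

Lemma homogB m (deg : 'I_m -> nat) j u v :
  ishomog deg j u -> ishomog deg j v -> ishomog deg j (u - v).
Proof. by rewrite /ishomog homog_partB => -> ->. Qed.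

Definition homog_mx m' m (deg' : 'I_m' -> nat) (deg : 'I_m -> nat)
    (D : 'M[S]_(m', m)) :=
  forall k l, homog_of_shift (deg l) (deg' k) (D k l).

Lemma homog_partM m' m (deg' : 'I_m' -> nat) (deg : 'I_m -> nat) D j u :
  homog_mx deg' deg D ->
  homog_part deg j (u *m D) = homog_part deg' j u *m D.
Proof.
move=> hD; apply/rowP => l; rewrite !mxE hpart_sum; apply: eq_bigr => k _.
by rewrite (hpartM _ _ (hD k l)) !mxE.
Qed.

Lemma homogM m' m (deg' : 'I_m' -> nat) (deg : 'I_m -> nat) D j u :
  homog_mx deg' deg D -> ishomog deg' j u -> ishomog deg j (u *m D).
Proof. by move=> hD hu; rewrite /ishomog (homog_partM _ _ hD) hu. Qed.

(** A nonzero constant coordinate puts its generator in degree [j]; this is how a nonzero Betti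
    number is detected. *)
Lemma homog_neq0 m (deg : 'I_m -> nat) j u k :
  ishomog deg j u -> (u ord0 k)@_0%MM != 0 -> deg k = j.
Proof.
move=> /rowP/(_ k); rewrite mxE => <-; rewrite mcoeff_hpart mdeg0 add0n.
by case: ifP => [/eqP //|]; rewrite eqxx.
Qed.

Lemma homog_delta m (deg : 'I_m -> nat) k : ishomog deg (deg k) (delta_mx 0 k).
Proof.
apply/rowP => l; rewrite !mxE /=; apply/mpolyP => m'; rewrite mcoeff_hpart.
case: (l =P k) => [-> | _]; last by rewrite mcoeff0 if_same.
rewrite mcoeff1; case: (m' =P 0%MM) => [->|_]; rewrite ?if_same //.
by rewrite mdeg0 add0n eqxx.
Qed.

Definition row_in_vars m (s : seq 'I_n) (u : 'rV[S]_m) :=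
  forall k, in_vars s (u ord0 k).

Lemma row_in_varsD m s (u v : 'rV[S]_m) :
  row_in_vars s u -> row_in_vars s v -> row_in_vars s (u + v).
Proof. by move=> hu hv k; rewrite mxE; apply: in_varsD. Qed.

Lemma row_in_varsZ m s p (u : 'rV[S]_m) :
  row_in_vars s u -> row_in_vars s (p *: u).
Proof. by move=> hu k; rewrite mxE; apply: in_varsMl. Qed.

Lemma row_in_varsB m s (u v : 'rV[S]_m) :
  row_in_vars s u -> row_in_vars s v -> row_in_vars s (u - v).
Proof.
by move=> hu hv; rewrite -scaleN1r; apply: row_in_varsD (row_in_varsZ _ hv).
Qed.

Lemma row_in_vars0 m s : row_in_vars s (0 : 'rV[S]_m).
Proof. by move=> k; rewrite mxE; apply: in_vars0. Qed.

Lemma row_in_varsM m m' s (u : 'rV[S]_m) (D : 'M[S]_(m, m')) :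
  row_in_vars s u -> row_in_vars s (u *m D).
Proof.
move=> hu k; rewrite mxE; apply: (big_ind (in_vars s)) => [||i _].
- exact: in_vars0.
- exact: in_varsD.
by rewrite mulrC; apply: in_varsMl.
Qed.

Lemma row_in_varsX m s i (u : 'rV[S]_m) : i \in s -> row_in_vars s ('X_i *: u).
Proof. by move=> si k; rewrite mxE; apply: in_varsX. Qed.

Lemma row_in_varsX_inv m s i (u : 'rV[S]_m) :
  i \notin s -> row_in_vars s ('X_i *: u) -> row_in_vars s u.
Proof. by move=> si hu k; apply: (in_varsX_inv si); have := hu k; rewrite mxE. Qed.

Lemma row_in_vars_sub m s t (u : 'rV[S]_m) :
  {subset s <= t} -> row_in_vars s u -> row_in_vars t u.
Proof. by move=> st hu k; apply: in_vars_sub (hu k). Qed.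

Lemma row_in_vars_part m (deg : 'I_m -> nat) s j u :
  row_in_vars s u -> row_in_vars s (homog_part deg j u).
Proof. by move=> hu k; rewrite mxE; apply: in_vars_hpart. Qed.

Lemma row_in_vars_split m i s (u : 'rV[S]_m) : row_in_vars (i :: s) u ->
  exists a b, row_in_vars s a /\ u = 'X_i *: b + a.
Proof.
move=> hu; have {hu} h k := in_vars_cons (hu k).
pose a k := sval (constructive_indefinite_description _ (h k)).
have h' k : exists b, in_vars s (a k) /\ u ord0 k = 'X_i * b + a k.
  by rewrite /a; case: (constructive_indefinite_description _ _).
pose b k := sval (constructive_indefinite_description _ (h' k)).
have h'' k : in_vars s (a k) /\ u ord0 k = 'X_i * b k + a k.
  by rewrite /b; case: (constructive_indefinite_description _ _).
exists (\row_k a k), (\row_k b k); split=> [k|].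
  by rewrite mxE; case: (h'' k).
by apply/rowP => k; rewrite !mxE; case: (h'' k).
Qed.

(* In the first case j may be 0, where b would have degree -1. *)
Lemma homog_split m (deg : 'I_m -> nat) i s j u :
  ishomog deg j u -> row_in_vars (i :: s) u ->
  (row_in_vars s u) \/
  exists j' a b, [/\ j = j'.+1, row_in_vars s a, ishomog deg j' b
    & u = 'X_i *: b + a].
Proof.
move=> hu /row_in_vars_split[a [b [sa e]]].
case: j hu => [|j]; rewrite /ishomog e homog_partD => hu.
  left; rewrite -hu; apply: row_in_varsD; last exact: row_in_vars_part.
  suff -> : homog_part deg 0 ('X_i *: b) = 0 by apply: row_in_vars0.
  by apply/rowP => k; rewrite !mxE hpartX0.
right; exists j, (homog_part deg j.+1 a), (homog_part deg j b); split=> //.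
- exact: row_in_vars_part.
- exact: homog_partK.
by rewrite -hu homog_partX.
Qed.

(** For a submodule [N] this is [(s) N], with one element of [N] collected per variable. *)
Fixpoint vars_mul m (N : 'rV[S]_m -> Prop) (s : seq 'I_n) (u : 'rV[S]_m) :=
  if s is i :: s' then
    exists w v, [/\ N w, vars_mul N s' v & u = 'X_i *: w + v]
  else u = 0.

Lemma vars_mul_im m' m (N : 'rV[S]_m -> Prop) (D : 'M[S]_(m', m)) s u :
  (forall v, N v -> exists w, v = w *m D) -> vars_mul N s u ->
  exists2 a, row_in_vars s a & u = a *m D.
Proof.
move=> hN; elim: s u => [|i s IHs] u /=.
  by move=> ->; exists 0; rewrite ?mul0mx //; apply: row_in_vars0.
case=> w [v [/hN[w' ->] /IHs[a sa ->] ->]].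
exists ('X_i *: w' + a); last by rewrite mulmxDl scalemxAl.
apply: row_in_varsD; first by apply: row_in_varsX; rewrite mem_head.
by apply: row_in_vars_sub sa => k ks; rewrite inE ks orbT.
Qed.

Variable y : 'I_n.

(* With F the ambient graded free module, [N /\ (s) F = (s) N] in degrees
   greater than c, i.e. Tor_1(F/N, S/(s)) vanishes there, for every list s of
   distinct variables containing y. *)
Definition tor_bounded m (deg : 'I_m -> nat) (N : 'rV[S]_m -> Prop) c :=
  forall s j u, uniq (rcons s y) -> (c < j)%N -> N u -> ishomog deg j u ->
    row_in_vars (rcons s y) u -> vars_mul N (rcons s y) u.

(** Variables are added one at a time to [y], which is a nonzerodivisor modulo [N]. If
    [u = 'X_i *: b + a] and [b] agrees modulo the other variables with some [w] in [N], then
    [u - 'X_i *: w] falls under the induction hypothesis. *)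
Lemma tor_bounded_ind m (deg : 'I_m -> nat) (N : 'rV[S]_m -> Prop) c :
  submodule N -> graded deg N -> (forall b, N ('X_y *: b) -> N b) ->
  (forall s i j a b, uniq (rcons (i :: s) y) -> (c <= j)%N ->
    row_in_vars (rcons s y) a -> N ('X_i *: b + a) -> ishomog deg j b ->
    exists2 w, N w & row_in_vars (rcons s y) (b - w)) ->
  tor_bounded deg N c.
Proof.
move=> hN gN nzN H; elim=> [|i s IHs] j u /=.
  move=> _ cj Nu _ /row_in_vars_split[a [b [sa e]]].
  have ea : a = 0.
    by apply/rowP => k; rewrite mxE; apply/mpolyP => m'; rewrite mcoeff0; apply: sa.
  by exists b, 0; split; rewrite // -?ea //; apply: nzN; rewrite -[X in N X]addr0 -ea -e.
move=> /= Us cj Nu hu /(homog_split hu)[su|[j' [a [b [ej sa hb e]]]]].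
  exists 0, u; rewrite scaler0 add0r; split=> //; first exact: submod0.
  by case/andP: Us => _ Us; apply: IHs hu su.
have cj' : (c <= j')%N by rewrite -ltnS -ej.
rewrite e in Nu; have [w Nw sw] := H s i j' a b Us cj' sa Nu hb.
(* Only the degree [j'] part of [w] is used, to keep the remainder homogeneous of degree [j]. *)
exists (homog_part deg j' w), (u - 'X_i *: homog_part deg j' w).
have Nw' : N (homog_part deg j' w) by apply: gN.
split=> //; last by rewrite addrC subrK.
apply: (IHs j); first by case/andP: Us.
- by [].
- by apply: submodB => //; [rewrite e | apply: submodZ].
- by apply: homogB => //; rewrite ej; apply: homogX; apply: homog_partK.
rewrite e addrAC -scalerBr; apply: row_in_varsD => //; apply: row_in_varsZ.
by rewrite -{1}hb -homog_partB; apply: row_in_vars_part.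
Qed.

(** In degrees greater than [r] every [b] lies in [N + (y) F]. The bound is [r.+1] because
    ['X_i *: b] has one degree more than [b]. *)
Lemma tor_bounded_top m (deg : 'I_m -> nat) (N : 'rV[S]_m -> Prop) r :
  submodule N -> graded deg N -> (forall b, N ('X_y *: b) -> N b) ->
  (forall j b, (r < j)%N -> ishomog deg j b -> exists v, N (b - 'X_y *: v)) ->
  tor_bounded deg N r.+1.
Proof.
move=> hN gN nzN top; apply: tor_bounded_ind => // s i j a b _ rj _ _ hb.
have [v Nv] := top j b rj hb; exists (b - 'X_y *: v) => //.
by rewrite opprB addrC subrK; apply: row_in_varsX; rewrite mem_rcons mem_head.
Qed.

Definition kernel m' m (D : 'M[S]_(m', m)) (u : 'rV[S]_m') := u *m D = 0.

Lemma kernel_submod m' m (D : 'M[S]_(m', m)) : submodule (kernel D).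
Proof.
rewrite /kernel; split=> [|u v hu hv|p u hu]; first by rewrite mul0mx.
  by rewrite mulmxDl hu hv addr0.
by rewrite -scalemxAl hu scaler0.
Qed.

Lemma kernel_graded m' m deg' deg (D : 'M[S]_(m', m)) :
  homog_mx deg' deg D -> graded deg' (kernel D).
Proof.
by move=> hD j u hu; rewrite /kernel -(homog_partM _ _ hD) hu homog_part0.
Qed.

Lemma scaleXI m i (u : 'rV[S]_m) : 'X_i *: u = 0 -> u = 0.
Proof.
move=> /rowP h; apply/rowP => k; apply/mpolyP => m'.
have := congr1 (mcoeff (U_(i) + m')%MM) (h k).
by rewrite !mxE mcoeffXM !mcoeff0.
Qed.

(* Dimension shift: the kernel of a cover of N is one degree worse than N. *)
Lemma tor_bounded_kernel m' m deg' deg (D : 'M[S]_(m', m)) N c :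
  homog_mx deg' deg D -> (forall u, N u <-> exists w, u = w *m D) ->
  tor_bounded deg N c -> tor_bounded deg' (kernel D) c.+1.
Proof.
move=> hD imD bN; apply: tor_bounded_ind.
- exact: kernel_submod.
- exact: kernel_graded hD.
- by move=> b; rewrite /kernel -scalemxAl => /scaleXI.
move=> s i j a b /= /andP[nis Us] cj sa ker_ab hb.
(* Since ['X_i *: b *m D = - (a *m D)] has entries in the ideal of the other variables, ['X_i] can
   be cancelled. *)
have sb : row_in_vars (rcons s y) (b *m D).
  apply: (row_in_varsX_inv nis); rewrite scalemxAl.
  have -> : 'X_i *: b *m D = 0 - a *m D.
    by apply/eqP; rewrite eq_sym subr_eq -mulmxDl ker_ab.
  by apply: row_in_varsB; [apply: row_in_vars0 | apply: row_in_varsM].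
have NbD : N (b *m D) by apply/imD; exists b.
(* The bound for [N] writes [b *m D] as [a' *m D] with [a'] in [(s) F'], so [b - a'] is in the
   kernel. *)
have /(vars_mul_im (fun v => (imD v).1))[a' sa' e] :=
  bN s j (b *m D) Us cj NbD (homogM hD hb) sb.
exists (b - a'); first by rewrite /kernel mulmxBl e subrr.
by rewrite opprB addrC subrK.
Qed.

End GradedModules.

(** * Minimal homogeneous covers *)

Section Generators.
Variables (K : fieldType) (n m : nat) (deg : 'I_m -> nat).
Local Notation S := {mpoly K[n]}.
Local Notation F := 'rV[S]_m.

(** Elements of a fixed degree form a space over [K] but not a module over [S], hence this weaker
    notion. *)
Record Ksubspace (P : F -> Prop) : Prop := KSubspace {
  Ksub0 : P 0;
  KsubD : forall u v, P u -> P v -> P (u + v);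
  KsubZ : forall (c : K) u, P u -> P (c%:MP *: u)
}.

Lemma submodule_Ksubspace P : submodule P -> Ksubspace P.
Proof. by case=> P0 PD PZ; split=> // c u; apply: PZ. Qed.

Lemma KsubB P u v : Ksubspace P -> P u -> P v -> P (u - v).
Proof.
move=> hP Pu Pv; apply: KsubD => //.
by have := KsubZ hP (-1) Pv; rewrite mpolyCN mpolyC1 scaleN1r.
Qed.

Definition in_Kspan (s : seq F) (u : F) : Prop :=
  forall P, Ksubspace P -> {in s, forall g, P g} -> P u.

Lemma in_Kspan_subspace s : Ksubspace (in_Kspan s).
Proof.
split=> [|u v hu hv|c u hu] P hP sP; first exact: Ksub0.
  by apply: KsubD => //; [apply: hu | apply: hv].
by apply: KsubZ => //; apply: hu.
Qed.

Lemma in_Kspan_cons g s u : in_Kspan (g :: s) u ->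
  exists (c : K) w, in_Kspan s w /\ u = c%:MP *: g + w.
Proof.
have hs := in_Kspan_subspace s.
move/(_ (fun u => exists (c : K) w, in_Kspan s w /\ u = c%:MP *: g + w)).
apply; first split.
- by exists 0, 0; rewrite mpolyC0 scale0r addr0; split=> //; apply: (Ksub0 hs).
- move=> u1 u2 [c [w [hw ->]]] [d [v [hv ->]]]; exists (c + d), (w + v).
  by split; [apply: (KsubD hs) | rewrite mpolyCD scalerDl addrACA].
- move=> a u1 [c [w [hw ->]]]; exists (a * c), (a%:MP *: w).
  by split; [apply: (KsubZ hs) | rewrite scalerDr scalerA mpolyCM].
move=> h; rewrite inE => /predU1P[->|hh].
  by exists 1, 0; rewrite mpolyC1 scale1r addr0; split=> //; apply: (Ksub0 hs).
by exists 0, h; rewrite mpolyC0 scale0r add0r; split=> // P _; apply.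
Qed.

(** Gaussian elimination: an element of [P] with coefficient 1 on [g] serves as pivot, and the rest
    of [P] is reduced to the span of [s]. *)
Lemma Ksubspace_fin_gen (s : seq F) (P : F -> Prop) :
  Ksubspace P -> (forall u, P u -> in_Kspan s u) ->
  exists s', {in s', forall g, P g} /\ (forall u, P u -> in_Kspan s' u).
Proof.
elim: s P => [|g s IHs] P hP Ps; first by exists [::].
have hs := in_Kspan_subspace s.
have [[v [Pv vg]]|nv] := classic (exists v, P v /\ in_Kspan s (v - g)).
  have [||s' [s'P hs']] := IHs (fun u => P u /\ in_Kspan s u).
  - split=> [|u w [? ?] [? ?]|c u [? ?]].
    + by split; [apply: (Ksub0 hP) | apply: (Ksub0 hs)].
    + by split; [apply: (KsubD hP) | apply: (KsubD hs)].
    + by split; [apply: (KsubZ hP) | apply: (KsubZ hs)].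
  - by move=> u [].
  exists (v :: s'); split=> [h|u Pu].
    by rewrite inE => /predU1P[->|/s'P[]].
  have [c [w [sw eu]]] := in_Kspan_cons (Ps u Pu).
  have Pcv : P (u - c%:MP *: v) by apply: KsubB => //; apply: KsubZ.
  have scv : in_Kspan s (u - c%:MP *: v).
    have -> : u - c%:MP *: v = w - c%:MP *: (v - g).
      by rewrite eu scalerBr opprB addrCA addrA.
    by apply: (KsubB hs) => //; apply: (KsubZ hs).
  move=> Q hQ sQ; rewrite -(subrK (c%:MP *: v) u); apply: KsubD => //.
    by apply: (hs' _ (conj Pcv scv)) => // h hh; apply: sQ; rewrite inE hh orbT.
  by apply: KsubZ => //; apply: sQ; rewrite mem_head.
apply: (IHs P hP) => u Pu.
have [c [w [sw eu]]] := in_Kspan_cons (Ps u Pu).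
have [c0|c0] := eqVneq c 0; first by rewrite eu c0 mpolyC0 scale0r add0r.
(* An element with coefficient [c] nonzero on [g] could be rescaled to a pivot. *)
case: nv; exists (c^-1%:MP *: u); split; first exact: KsubZ.
rewrite eu scalerDr scalerA -mpolyCM mulVf // mpolyC1 scale1r addrAC subrr add0r.
exact: (KsubZ hs).
Qed.

Lemma row_mpolyE (u : F) :
  u = \sum_k \sum_(m' <- msupp (u ord0 k))
        ((u ord0 k)@_m')%:MP *: ('X_[m'] *: delta_mx 0 k).
Proof.
rewrite [LHS]row_sum_delta; apply: eq_bigr => k _.
rewrite [u 0 k in LHS]mpolyE scaler_suml; apply: eq_bigr => m' _.
by rewrite scalerA mul_mpolyC.
Qed.

(** All monomials of degree at most [j] are taken on every generator, whatever its degree: a finite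
    list spanning at least the degree [j] part. *)
Definition hom_basis j : seq F :=
  [seq 'X_[val x.1] *: delta_mx 0 x.2
     | x <- enum (('X_{1..n < j.+1} * 'I_m)%type : finType)].

Lemma hom_basisP j u : ishomog deg j u -> in_Kspan (hom_basis j) u.
Proof.
move=> hu P hP sP; rewrite [u]row_mpolyE.
apply: big_ind => [||k _]; [exact: Ksub0 | exact: KsubD | ].
rewrite big_seq; apply: big_ind => [||m']; [exact: Ksub0 | exact: KsubD | ].
rewrite mcoeff_msupp => um; apply: KsubZ => //; apply: sP.
have dm : (mdeg m' < j.+1)%N.
  move: um; rewrite -{1}hu mxE mcoeff_hpart ltnS.
  by case: ifP => [/eqP <- _|]; rewrite ?eqxx // leq_addr.
by apply/mapP; exists (BMultinom dm, k); rewrite ?mem_enum.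
Qed.

Variable N : F -> Prop.
Hypotheses (hN : submodule N) (gN : graded deg N).

Lemma sum_homog_part (u : F) :
  exists d, u = \sum_(j < d) homog_part deg j u.
Proof.
(* [msize] exceeds the degree of every monomial, so all degrees occurring in [u] are below [d]. *)
pose d := \max_(k < m) (msize (u ord0 k) + deg k)%N.
exists d; apply/rowP => k; apply/mpolyP => m'.
rewrite summxE raddf_sum /=; under eq_bigr do rewrite mxE mcoeff_hpart.
have [um|/memN_msupp_eq0 ->] := boolP (m' \in msupp (u ord0 k)); last first.
  by rewrite big1 // => i _; rewrite if_same.
have lt_d : (mdeg m' + deg k < d)%N.
  apply: leq_trans (leq_bigmax k).
  by rewrite -addSn leq_add2r; apply: msize_mdeg_lt.
rewrite (bigD1 (Ordinal lt_d)) //= eqxx big1 ?addr0 // => i /negPf ni.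
by case: eqP => // e; move: ni; rewrite -val_eqE /= e eqxx.
Qed.

(** Each graded piece of [N] is finitely spanned over [K]; the list collects spanning sets of the
    pieces below degree [c], tagged with their degrees. *)
Lemma homog_gens_le c : exists L : seq (F * nat),
  {in L, forall x, N x.1 /\ ishomog deg x.2 x.1} /\
  (forall P, submodule P -> {in L, forall x, P x.1} ->
     forall j u, (j < c)%N -> N u -> ishomog deg j u -> P u).
Proof.
elim: c => [|c [L [hL LP]]]; first by exists [::].
have [||s [sN hs]] :=
  @Ksubspace_fin_gen (hom_basis c) (fun u => N u /\ ishomog deg c u).
- split=> [|u v [Nu hu] [Nv hv]|a u [Nu hu]].
  + by split; [apply: submod0 | apply: homog_part0].
  + by split; [apply: submodD | apply: homogD].
  split; first exact: submodZ.
  rewrite /ishomog -{2}hu; apply/rowP => k; rewrite !mxE; apply/mpolyP => m'.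
  by rewrite mcoeff_hpart !mcoeffCM mcoeff_hpart; case: ifP; rewrite ?mulr0.
- by move=> u [_ /hom_basisP].
exists (L ++ [seq (g, c) | g <- s]); split=> [x|P hP LsP j u].
  by rewrite mem_cat => /orP[/hL //|/mapP[g /sN[Ng hg] ->]].
rewrite ltnS leq_eqVlt => /predU1P[->|jc] Nu hu; last first.
  by apply: LP hu => // x xL; apply: LsP; rewrite mem_cat xL.
apply: (hs u (conj Nu hu)); first exact: submodule_Ksubspace.
move=> g gs; apply: (LsP (g, c)); rewrite mem_cat; apply/orP; right.
by apply/mapP; exists g.
Qed.

Lemma vars_mul_homog s j (P : F -> Prop) u : submodule P ->
  (forall w, N w -> ishomog deg j w -> P w) -> vars_mul N s u ->
  P (homog_part deg j.+1 u).
Proof.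
move=> hP NP; elim: s u => [|i s IHs] u /=.
  by move=> ->; rewrite homog_part0; apply: submod0.
case=> w [v [Nw /IHs Pv ->]]; rewrite homog_partD homog_partX.
apply: submodD => //; apply: submodZ => //; apply: NP; first exact: gN.
exact: homog_partK.
Qed.

(* Graded Nakayama: as N = (s) N in degrees greater than c, the finitely many
   generators of degree at most c suffice, and Noetherianity is not needed. *)
Lemma homog_gens c s :
  (forall j u, (c < j)%N -> N u -> ishomog deg j u -> vars_mul N s u) ->
  exists L : seq (F * nat),
  {in L, forall x, N x.1 /\ ishomog deg x.2 x.1} /\
  (forall P, submodule P -> {in L, forall x, P x.1} -> forall u, N u -> P u).
Proof.
move=> Nc; have [L [hL LP]] := homog_gens_le c.+1; exists L; split=> // P hP PL.
suff Pj j u : N u -> ishomog deg j u -> P u.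
  move=> u Nu; have [d ->] := sum_homog_part u; apply: submod_sum => // i _.
  by apply: Pj; [apply: gN | apply: homog_partK].
elim: j u => [|j IHj] u Nu hu; first exact: LP hu.
have [jc|cj] := ltnP j.+1 c.+1; first exact: LP hu.
by rewrite -hu; apply: (vars_mul_homog hP IHj (Nc _ _ cj Nu hu)).
Qed.

(** * Covers by graded free modules and their minimization *)

Record homog_cover m' (deg' : 'I_m' -> nat) (D : 'M[S]_(m', m)) : Prop := {
  cover_homog : homog_mx deg' deg D;
  cover_im : forall u, N u <-> exists w, u = w *m D
}.

Lemma homog_mxP m' (deg' : 'I_m' -> nat) (D : 'M[S]_(m', m)) :
  (forall k, ishomog deg (deg' k) (row k D)) -> homog_mx deg' deg D.
Proof.
move=> hD k l m0; have /rowP/(_ l) := hD k; rewrite !mxE => <-.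
rewrite mcoeff_msupp mcoeff_hpart.
by case: ifP => [/eqP //|]; rewrite eqxx.
Qed.

Lemma cover_exists c s :
  (forall j u, (c < j)%N -> N u -> ishomog deg j u -> vars_mul N s u) ->
  exists m' (deg' : 'I_m' -> nat) D, homog_cover deg' D.
Proof.
move=> /homog_gens[L [hL LP]].
pose x0 : F * nat := (0, 0%N).
have Lx (i : 'I_(size L)) : nth x0 L i \in L by apply: mem_nth.
exists (size L), (fun i => (nth x0 L i).2), (\matrix_i (nth x0 L i).1).
split=> [|u].
  by apply: homog_mxP => k; rewrite rowK; case: (hL _ (Lx k)).
split=> [Nu|[w ->]].
  apply: (LP (fun u => exists w, u = w *m _)) u Nu.
    split=> [|_ _ [v ->] [w ->]|p _ [v ->]].
    - by exists 0; rewrite mul0mx.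
    - by exists (v + w); rewrite mulmxDl.
    by exists (p *: v); rewrite scalemxAl.
  move=> x /(nthP x0)[i iL <-]; exists (delta_mx 0 (Ordinal iL)).
  by rewrite -rowE rowK.
rewrite mulmx_sum_row; apply: submod_sum => // i _; apply: submodZ => //.
by rewrite rowK; case: (hL _ (Lx i)).
Qed.

(** A relation with a nonzero constant coefficient at [k] expresses row [k] through the other rows,
    which can then be deleted; the number of rows decreases. *)
Lemma min_cover_exists m' (deg' : 'I_m' -> nat) D : homog_cover deg' D ->
  exists m'' (deg'' : 'I_m'' -> nat) (D' : 'M[S]_(m'', m)),
    homog_cover deg'' D' /\
    (forall u k, kernel D' u -> (u ord0 k)@_0%MM = 0).
Proof.
elim: m' deg' D => [|m' IHm] deg' D [hD imD].
  by exists 0%N, deg', D; split=> // u [].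
have [[u [k [Du uk]]]|min] :=
  classic (exists u k, kernel D u /\ (u ord0 k)@_0%MM <> 0); last first.
  exists m'.+1, deg', D; split=> // u k Du.
  by apply/eqP; apply/negPn/negP => /eqP uk; case: min; exists u, k.
apply: (IHm (fun i => deg' (lift k i)) (row' k D)); split=> [i l|v].
  by rewrite mxE; apply: hD.
have sum_row' (w : 'rV[S]_m'.+1) :
    w *m D = w 0 k *: row k D + col' k w *m row' k D.
  apply/rowP => l; rewrite mxE (bigD1_ord k) //= !mxE; congr (_ + _).
  by apply: eq_bigr => i _; rewrite !mxE.
have Drow' (w : 'rV[S]_m') : exists w', w *m row' k D = w' *m D.
  exists (\row_i (if unlift k i is Some j then w 0 j else 0)).
  rewrite sum_row' mxE unlift_none scale0r add0r; congr (_ *m _).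
  by apply/rowP => i; rewrite !mxE liftK.
rewrite imD; split=> [[w ->]|[w ->]]; last exact: Drow'.
(* In degree [deg' k] the coordinate at [k] is reduced to its constant term, hence invertible. *)
pose h := homog_part deg' (deg' k) u.
have Dh : h *m D = 0 by rewrite -(homog_partM _ _ hD) [u *m D]Du homog_part0.
have hk : h 0 k = ((u 0 k)@_0%MM)%:MP.
  rewrite mxE; apply/mpolyP => m0; rewrite mcoeff_hpart mcoeffC.
  rewrite -{2}(add0n (deg' k)) eqn_add2r mdeg_eq0.
  by case: eqP => [->|]; rewrite ?mulr1 ?mulr0.
pose c : S := ((u 0 k)@_0%MM)^-1%:MP.
have ek : row k D = - (c *: (col' k h *m row' k D)).
  have ch : c * h 0 k = 1 by rewrite hk -mpolyCM mulVf ?mpolyC1 //; apply/eqP.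
  move/(congr1 (fun z => c *: z)): Dh.
  rewrite sum_row' scaler0 scalerDr scalerA ch scale1r => /eqP.
  by rewrite addr_eq0 => /eqP.
exists (col' k w - (w 0 k * c) *: col' k h).
by rewrite sum_row' ek mulmxBl scalerN scalerA addrC -scalemxAl.
Qed.

End Generators.

(** * Regularity from the Artinian reduction *)

Section Regularity.
Variables (K : fieldType) (n : nat) (y : 'I_n) (r : nat).
Local Notation S := {mpoly K[n]}.
Variable I : S -> Prop.

(* X_y is a nonzerodivisor on S/I, and S/(I, X_y) has top degree r. *)
Record top_degree_ideal : Prop := TopDegreeIdeal {
  ideal0 : I 0;
  idealD : forall f g, I f -> I g -> I (f + g);
  idealM : forall f g, I g -> I (f * g);
  ideal_graded : forall j f, I f -> I (hpart 0 j f);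
  ideal_nzd : forall f, I ('X_y * f) -> I f;
  ideal_above : forall j f, (r < j)%N -> hpart 0 j f = f ->
    exists g, I (f - 'X_y * g);
  ideal_top : exists2 f, hpart 0 r f = f & forall g, ~ I (f - 'X_y * g)
}.

Hypothesis hI : top_degree_ideal.

Let vars := rcons (rem y (enum 'I_n)) y.

Let vars_uniq : uniq vars.
Proof.
by rewrite rcons_uniq (rem_uniq _ (enum_uniq _)) mem_rem_uniqF ?enum_uniq.
Qed.

Let mem_vars i : i \in vars.
Proof.
rewrite mem_rcons inE; case: eqVneq => //= niy.
by rewrite mem_rem_uniq ?enum_uniq // !inE niy mem_enum.
Qed.

Let row_in_all_vars m (u : 'rV[S]_m) :
  (forall k, (u ord0 k)@_0%MM = 0) -> row_in_vars vars u.
Proof.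
move=> hu k m0 hm; suff -> : m0 = 0%MM by [].
by apply/mnmP => i; rewrite mnm0E hm.
Qed.

Let row_in_vars_coef0 m s (u : 'rV[S]_m) k :
  row_in_vars s u -> (u ord0 k)@_0%MM = 0.
Proof. by apply=> i _; rewrite mnm0E. Qed.

(** By gradedness a nonzero constant term would put 1 in [I], contradicting [ideal_top]. *)
Lemma ideal_const f : I f -> f@_0%MM = 0.
Proof.
move=> If; apply/eqP/negPn/negP => f0.
have I1 : I 1.
  have := idealM hI (f@_0%MM)^-1%:MP (ideal_graded hI 0 If).
  suff -> : (f@_0)^-1%:MP * hpart 0 0 f = 1 by [].
  apply/mpolyP => m; rewrite mcoeffCM mcoeff_hpart mcoeff1 addn0 mdeg_eq0.
  by case: eqP => [->|]; rewrite ?mulVf ?mulr0.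
have [s _ /(_ 0)] := ideal_top hI; apply.
by rewrite -[_ - _]mulr1; apply: idealM.
Qed.

(** A step of the resolution: the free module reached so far and the submodule to be covered next,
    with the minimality and Tor bound that allow another step. *)
Record stage := Stage {
  stage_rk : nat;
  stage_deg : 'I_stage_rk -> nat;
  stage_rel : 'rV[S]_stage_rk -> Prop;
  stage_bound : nat;
  _ : submodule stage_rel;
  _ : graded stage_deg stage_rel;
  _ : forall u k, stage_rel u -> (u ord0 k)@_0%MM = 0;
  _ : tor_bounded y stage_deg stage_rel stage_bound
}.

Lemma stage_coef0 (s : stage) (u : 'rV[S]_(stage_rk s)) k :
  stage_rel u -> (u ord0 k)@_0%MM = 0.
Proof. by case: s u k => m deg N c hN gN mN tN u k; apply: mN. Qed.

(** Relations without constant terms lie in [(vars) F], so the Tor bound gives [N = (vars) N] in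
    high degrees. Hence a finite cover exists; the kernel of a minimal one is the next stage. *)
Lemma next_stage (s : stage) : exists (t : stage)
  (D : 'M[S]_(stage_rk t, stage_rk s)),
  homog_cover (@stage_deg s) (@stage_rel s) (@stage_deg t) D /\
  (forall u, stage_rel u <-> kernel D u).
Proof.
case: s => m deg N c hN gN mN tN /=.
have [|m1 [deg1 [D1 cov1]]] := @cover_exists _ _ _ deg _ hN gN c vars.
  move=> j u cj Nu hu; apply: (tN (rem y (enum 'I_n)) j u vars_uniq cj Nu hu).
  by apply: row_in_all_vars => k; apply: mN.
have [m' [deg' [D [cov minD]]]] := min_cover_exists cov1.
have [hD imD] := cov.
have tD := tor_bounded_kernel hD imD tN.
exists (Stage (kernel_submod D) (kernel_graded hD) (fun u k h => minD u k h) tD).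
by exists D.
Qed.

Lemma first_stage : exists s : stage, exists2 e : stage_rk s = 1%N,
  (forall k, stage_deg (s := s) k = 0%N) &
  forall u : 'rV[S]_(stage_rk s), stage_rel u <-> I (u ord0 (cast_ord (esym e) ord0)).
Proof.
pose N (u : 'rV[S]_1) := I (u ord0 ord0).
pose deg (k : 'I_1) := 0%N.
have hN : submodule N.
  rewrite /N; split=> [|u v hu hv|p u hu]; rewrite !mxE.
  - exact: ideal0.
  - exact: idealD.
  exact: idealM.
have gN : graded deg N by move=> j u hu; rewrite /N mxE; apply: ideal_graded.
have mN u k : N u -> (u ord0 k)@_0%MM = 0.
  by rewrite (ord1 k) => /ideal_const.
have tN : tor_bounded y deg N r.+1.
  apply: tor_bounded_top => // [b|j b rj hb].
    by rewrite /N mxE; apply: ideal_nzd.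
  have [|g Ig] := ideal_above hI (f := b 0 0) rj.
    by rewrite -{2}hb mxE.
  by exists (\row_k g); rewrite /N !mxE.
exists (Stage hN gN mN tN), erefl => //= u.
by rewrite /N; have -> : cast_ord (erefl 1%N) ord0 = ord0 :> 'I_1 by apply: ord1.
Qed.

Lemma resolution_exists : exists F, @minimal_free_resolution K n I F.
Proof.
have [s0 [e0 deg0 rel0]] := first_stage.
(* Choice turns [next_stage] into a function, iterated below. *)
have nxt s : {t : stage & {D : 'M[S]_(stage_rk t, stage_rk s) |
    homog_cover (@stage_deg s) (@stage_rel s) (@stage_deg t) D /\
    (forall u, stage_rel u <-> kernel D u)}}.
  have [t ht] := constructive_indefinite_description _ (next_stage s).
  by exists t; apply: constructive_indefinite_description.
pose st i := iter i (fun s => projT1 (nxt s)) s0.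
pose D i : 'M[S]_(stage_rk (st i.+1), stage_rk (st i)) := sval (projT2 (nxt (st i))).
have covD i : homog_cover (@stage_deg (st i)) (@stage_rel (st i)) (@stage_deg (st i.+1)) (D i).
  by have [] := svalP (projT2 (nxt (st i))).
have kerD i (u : 'rV[S]_(stage_rk (st i.+1))) : stage_rel u <-> kernel (D i) u.
  by have [_] := svalP (projT2 (nxt (st i))); apply.
pose k0 := cast_ord (esym e0) ord0.
have augE (u : 'rV[S]_(stage_rk s0)) : (u *m const_mx 1 : 'M_1) ord0 ord0 = u ord0 k0.
  rewrite mxE (bigD1 k0) //= mxE mulr1 big1 ?addr0 // => i.
  by rewrite -(inj_eq (@cast_ord_inj _ _ e0)) !ord1 eqxx.
exists (@FreeComplex K n (fun i => stage_rk (st i)) (fun i => @stage_deg (st i)) D (const_mx 1)).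
split=> /=.
- split=> [k|i]; last exact: cover_homog (covD i).
  by move=> m0; rewrite mxE msupp1 inE => /eqP ->; rewrite mdeg0 deg0.
- move=> f; exists (const_mx f); rewrite augE mxE subrr; exact: ideal0.
- by move=> u; rewrite augE -rel0; apply: cover_im (covD 0%N) u.
- by move=> i u; rewrite -[_ = 0]/(kernel (D i) u) -kerD; apply: cover_im (covD i.+1) u.
(* Minimality: the rows of [D i] are themselves relations of stage [i]. *)
move=> i k l.
have : stage_rel (row k (D i)).
  by apply/(cover_im (covD i)); exists (delta_mx 0 k); rewrite rowE.
by move=> /(stage_coef0 l); rewrite mxE.
Qed.

(** * Betti numbers of an arbitrary minimal resolution *)

Section BettiBounds.

Let mulmxBZ m1 m2 m3 (b v : 'M[S]_(m1, m2)) p (D : 'M_(m2, m3)) i j :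
  ((b - p *: v) *m D) i j = (b *m D) i j - p * (v *m D) i j.
Proof.
by rewrite mulmxBl -scalemxAl mxE [X in _ + X]mxE [X in _ - X]mxE.
Qed.

Variable F : free_complex K n.
Hypothesis hF : minimal_free_resolution I F.

(** By exactness this is the image of [F_{i+1}] in [F_i], a syzygy module of S/I. *)
Definition relations i : 'rV[S]_(rk F i) -> Prop :=
  if i is i'.+1 then kernel (diff F i')
  else fun u => I ((u *m aug F) ord0 ord0).

Lemma relationsP i (u : 'rV[S]_(rk F i)) :
  relations u <-> exists w, u = w *m diff F i.
Proof.
case: hF => _ _ h0 hS _.
by case: i u => [|i] u; [apply: h0 | apply: hS].
Qed.

Let aug_homog : homog_mx (@deg K n F 0) (fun _ => 0%N) (aug F).
Proof. by case: hF => [[h _] _ _ _ _] k l; rewrite (ord1 l); apply: h. Qed.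

Let diff_homog i : homog_mx (@deg K n F i.+1) (@deg K n F i) (diff F i).
Proof. by case: hF => [[_ h] _ _ _ _] k l; apply: h. Qed.

Let mul_diff_coef0 i (w : 'rV[S]_(rk F i.+1)) : row_in_vars vars (w *m diff F i).
Proof.
case: hF => [_ _ _ _ h] k; rewrite mxE.
apply: (big_ind (in_vars vars)) => [|p q|j _]; first exact: in_vars0.
  exact: in_varsD.
apply: in_varsMl => m0 hm; suff -> : m0 = 0%MM by apply: h.
by apply/mnmP => i'; rewrite mnm0E hm.
Qed.

Lemma relations_coef0 i (u : 'rV[S]_(rk F i)) k :
  relations u -> (u ord0 k)@_0%MM = 0.
Proof. by move/relationsP => [w ->]; apply: (@row_in_vars_coef0 _ vars). Qed.

Lemma relations_submod i : submodule (@relations i).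
Proof.
case: i => [|i]; last exact: kernel_submod.
split=> [|u v hu hv|p u hu] /=.
- by rewrite mul0mx mxE; apply: (ideal0 hI).
- by rewrite mulmxDl mxE; apply: (idealD hI).
by rewrite -scalemxAl mxE; apply: (idealM hI).
Qed.

Lemma relations_above j (b : 'rV[S]_(rk F 0)) : (r < j)%N ->
  ishomog (@deg K n F 0) j b -> exists v, relations (b - 'X_y *: v).
Proof.
move=> rj hb; set f := (b *m aug F) ord0 ord0.
have [|g Ig] := ideal_above hI (f := f) rj.
  by have /rowP/(_ ord0) := homogM aug_homog hb; rewrite mxE.
have [_ /(_ g)[v Iv] _ _ _] := hF; exists v => /=.
rewrite mulmxBZ -/f.
rewrite -(subrK ('X_y * g) f) -addrA -mulrBr.
by apply: (idealD hI) => //; apply: (idealM hI).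
Qed.

Lemma relations_tor i :
  tor_bounded y (@deg K n F i) (@relations i) (r.+1 + i)%N.
Proof.
elim: i => [|i IHi].
  rewrite addn0; apply: tor_bounded_top.
  - exact: relations_submod.
  - move=> j u Iu /=; have /rowP/(_ ord0) := homog_partM j u aug_homog.
    by rewrite mxE => <-; apply: (ideal_graded hI).
  - by move=> b /=; rewrite -scalemxAl mxE; apply: (ideal_nzd hI).
  exact: relations_above.
rewrite addnS; apply: tor_bounded_kernel IHi => //.
exact: relationsP.
Qed.

(* The lift of an i-cycle of F/(s)F. *)
Definition cycle_mod i (s : seq 'I_n) : 'rV[S]_(rk F i) -> Prop :=
  if i is i'.+1 then fun u => row_in_vars s (u *m diff F i') else fun _ => True.

(* H_i(F/(s)F) vanishes in degrees greater than r + i. *)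
Lemma cycle_mod_above i s j u : uniq (rcons s y) -> (r + i < j)%N ->
  ishomog (@deg K n F i) j u -> cycle_mod (rcons s y) u ->
  exists2 a, row_in_vars (rcons s y) a & relations (u - a).
Proof.
case: i u => [|i] u Us rj hu /= su.
  rewrite addn0 in rj; have [v hv] := relations_above rj hu.
  by exists ('X_y *: v) => //; apply: row_in_varsX; rewrite mem_rcons mem_head.
have rel_u : relations (u *m diff F i) by apply/relationsP; exists u.
rewrite addnS -addSn in rj.
have /(vars_mul_im (fun v => (relationsP v).1))[a sa e] :=
  relations_tor Us rj rel_u (homogM (@diff_homog i) hu) su.
by exists a => //; rewrite /kernel mulmxBl e subrr.
Qed.

(** The connecting homomorphism: ['X_x *: u] lies one degree above the bound, so modulo [(s, y)] it
    is the boundary of some [w], which is a cycle modulo [(x, s, y)]. *)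
Lemma cycle_mod_top s : uniq (rcons s y) ->
  exists u : 'rV[S]_(rk F (size s)),
    [/\ ishomog (@deg K n F (size s)) (r + size s)%N u, cycle_mod (rcons s y) u
      & ~ exists2 a, row_in_vars (rcons s y) a & relations (u - a)].
Proof.
elim: s => [_|x s IHs] /=.
  have [f hf If] := ideal_top hI; have [_ /(_ f)[v Iv] _ _ _] := hF.
  (* In homological degree 0, [F_0] maps onto S/I, so the element of [ideal_top] lifts. *)
  exists (homog_part (@deg K n F 0) r v); split=> //.
    by rewrite addn0; apply: homog_partK.
  case=> a /row_in_vars_split[c [c0 [sc ->]]].
  have -> : c = 0.
    by apply/rowP => k; rewrite mxE; apply/mpolyP => m0; rewrite mcoeff0; apply: sc.
  rewrite addr0 /= mulmxBZ -(homog_partM _ _ aug_homog) mxE.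
  set g := (c0 *m _) _ _ => Ig.
  have Ir : I (f - hpart 0 r ((v *m aug F) ord0 ord0)).
    have := ideal_graded hI r Iv; rewrite hpartD hf.
    congr (I (_ + _)); apply/mpolyP => m0.
    by rewrite mcoeffN !mcoeff_hpart mcoeffN; case: (_ == _); rewrite ?oppr0.
  apply: (If g); rewrite -(subrK (hpart 0 r ((v *m aug F) ord0 ord0)) f).
  by rewrite -addrA; apply: (idealD hI).
case/andP => nxs Us; have [u [hu su nu]] := IHs Us.
have hxu : ishomog (@deg K n F (size s)) (r + size s).+1%N ('X_x *: u) by apply: homogX.
have sxu : cycle_mod (rcons s y) ('X_x *: u).
  case: (size s) u su {hu nu hxu} => //= i u su.
  by rewrite -scalemxAl; apply: row_in_varsZ.
have [a sa /relationsP[w0 ew0]] := cycle_mod_above Us (ltnSn _) hxu sxu.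
pose ad := homog_part (@deg K n F (size s)) (r + size s).+1%N a.
pose w := homog_part (@deg K n F (size s).+1) (r + size s).+1%N w0.
have sad : row_in_vars (rcons s y) ad by apply: row_in_vars_part.
have ew : 'X_x *: u - ad = w *m diff F (size s).
  by rewrite -(homog_partM _ _ (@diff_homog _)) -ew0 homog_partB hxu.
have sub_s : {subset rcons s y <= x :: rcons s y}.
  by move=> i; rewrite inE => ->; rewrite orbT.
exists w; split=> [||[b /row_in_vars_split[a1 [c [sa1 ->]]]]].
- by rewrite addnS; apply: homog_partK.
- rewrite /= -ew; apply: row_in_varsB; last exact: row_in_vars_sub sad.
  by apply: row_in_varsX; rewrite mem_head.
rewrite /= /kernel mulmxBl -ew mulmxDl -scalemxAl => /eqP.
rewrite subr_eq0 subr_eq => /eqP e.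
(* If the class of [w] vanished, cancelling ['X_x] would make [u] a boundary up to [(s, y)]. *)
apply: nu; exists (u - c *m diff F (size s)).
  apply: (row_in_varsX_inv nxs); rewrite scalerBr e addrAC [_ + _ - _]addrAC subrr add0r.
  by apply: row_in_varsD => //; apply: row_in_varsM.
by rewrite opprB addrC subrK; apply/relationsP; exists c.
Qed.

(** With all variables in [s], minimality makes each basis vector a cycle. Above the bound it would
    be a relation modulo the variables, but its constant coefficient is 1. *)
Lemma betti_le i j : betti F i j != 0%N -> (j <= r + i)%N.
Proof.
rewrite -lt0n => /card_gt0P[k]; rewrite inE => /eqP dk.
rewrite leqNgt; apply/negP => rj.
have [||a sa /(relations_coef0 k)] :=
  @cycle_mod_above i (rem y (enum 'I_n)) j (delta_mx 0 k) vars_uniq rj.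
- by rewrite -dk; apply: homog_delta.
- by case: (i) k dk {rj} => //= i' k _; apply: mul_diff_coef0.
rewrite !mxE !eqxx mcoeffB mcoeff1 eqxx (row_in_vars_coef0 k sa) subr0.
by move/eqP; rewrite oner_eq0.
Qed.

(** The [n.-1] variables other than [y] carry the top class to homological degree [n.-1]; being
    nonzero modulo all variables, it has a nonzero constant coordinate. *)
Lemma betti_top : betti F n.-1 (r + n.-1)%N != 0%N.
Proof.
have [u [hu _ nu]] := cycle_mod_top vars_uniq.
have sz : size (rem y (enum 'I_n)) = n.-1.
  by rewrite size_rem ?mem_enum // size_enum_ord.
rewrite -sz -lt0n; apply/card_gt0P.
have [k uk] : exists k, (u ord0 k)@_0%MM <> 0.
  apply: not_all_ex_not => u0; case: nu; exists u.
    exact: row_in_all_vars.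
  by rewrite subrr; apply: submod0 (relations_submod _).
by exists k; rewrite inE (homog_neq0 hu) //; apply/eqP.
Qed.

End BettiBounds.

Theorem quotient_regularity_top_degree : quotient_regularity I r%:Z.
Proof.
split=> [|F hF]; first exact: resolution_exists.
split=> [|i j /(betti_le hF)].
  exists n.-1, (r + n.-1)%N; split; first exact: betti_top.
  by rewrite PoszD addrK.
by rewrite lerBlDr -PoszD lez_nat.
Qed.

End Regularity.

(** * The ideal I(X_G) *)

Section CoefficientSums.
Variables (K : fieldType) (n : nat).
Local Notation S := {mpoly K[n]}.
Local Notation mon := 'X_{1..n}.

Definition coefsum (P : pred mon) (p : S) : K := (mpart P p).@[fun=> 1].

Lemma coefsumD P p q : coefsum P (p + q) = coefsum P p + coefsum P q.
Proof.
rewrite /coefsum -mevalD; congr (_.@[_]); apply/mpolyP => m.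
by rewrite mcoeffD !mcoeff_mpart mcoeffD; case: ifP; rewrite ?addr0.
Qed.

Lemma coefsumZ P c p : coefsum P (c *: p) = c * coefsum P p.
Proof.
rewrite /coefsum -mevalZ; congr (_.@[_]); apply/mpolyP => m.
by rewrite mcoeffZ !mcoeff_mpart mcoeffZ; case: ifP; rewrite ?mulr0.
Qed.

Lemma coefsum0 P : coefsum P 0 = 0.
Proof. by rewrite -(scale0r (0 : S)) coefsumZ mul0r. Qed.

Lemma coefsumB P p q : coefsum P (p - q) = coefsum P p - coefsum P q.
Proof. by rewrite coefsumD -scaleN1r coefsumZ mulN1r. Qed.

Lemma coefsum_sum P I (r : seq I) (Q : pred I) F :
  coefsum P (\sum_(i <- r | Q i) F i) = \sum_(i <- r | Q i) coefsum P (F i).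
Proof. exact: (big_morph _ (@coefsumD P) (coefsum0 P)). Qed.

Lemma coefsumX P m : coefsum P 'X_[m] = (P m)%:R.
Proof.
have -> : coefsum P 'X_[m] = (if P m then 'X_[m] else 0 : S).@[fun=> 1].
  congr (_.@[_]); apply/mpolyP => m'; rewrite mcoeff_mpart.
  case: ifP => Pm'; case: ifP => Pm; rewrite ?mcoeff0 // mcoeffX.
    by case: eqP => // e; rewrite e Pm' in Pm.
  by case: eqP => // e; rewrite -e Pm in Pm'.
case: (P m); last by rewrite meval0.
by rewrite mevalX big1 // => i _; rewrite expr1n.
Qed.

Lemma coefsumE P p : coefsum P p = \sum_(m <- msupp p) p@_m * (P m)%:R.
Proof.
rewrite {1}[p]mpolyE coefsum_sum; apply: eq_bigr => m _.
by rewrite coefsumZ coefsumX.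
Qed.

End CoefficientSums.

(** * Congruence of monomials modulo differences of squares *)

Section SquareIdeal.
Variables (K : fieldType) (G : sgraph) (v0 : G).
Local Notation R := {mpoly K[#|G|]}.
Local Notation vmon := 'X_{1..#|G|}.
Local Notation emon := 'X_{1..#|edges G|}.
Local Notation U := (ideal_span
  (fun ij : G * G => @xvar K G ij.1 ^+ 2 - xvar K ij.2 ^+ 2)).

(* Two monomials are congruent modulo the ideal iff they have the same key. *)
Definition key (M : vmon) : {set 'I_#|G|} * nat := ([set i | odd (M i)], mdeg M).

Lemma key_addl (N M1 M2 : vmon) :
  (key (N + M1) == key (N + M2)) = (key M1 == key M2).
Proof.
apply/eqP/eqP => -[/setP e d]; congr pair.
- by apply/setP => i; have := e i; rewrite !inE !mnmDE !oddD => /addbI.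
- by move: d; rewrite !mdegD => /addnI.
- by apply/setP => i; have := e i; rewrite !inE !mnmDE !oddD => ->.
by rewrite !mdegD d.
Qed.

Lemma square_ideal0 : U 0.
Proof. by exists (fun _ => 0); rewrite big1 // => i _; rewrite mul0r. Qed.

Lemma square_idealD p q : U p -> U q -> U (p + q).
Proof.
move=> [c ->] [d ->]; exists (fun i => c i + d i); rewrite -big_split.
by apply: eq_bigr => i _; rewrite mulrDl.
Qed.

Lemma square_idealM p q : U q -> U (p * q).
Proof.
move=> [c ->]; exists (fun i => p * c i); rewrite mulr_sumr.
by apply: eq_bigr => i _; rewrite mulrA.
Qed.

Lemma square_ideal_gen v w : U (xvar K v ^+ 2 - xvar K w ^+ 2).
Proof.
exists (fun ij => (ij == (v, w))%:R); rewrite (bigD1 (v, w)) //= eqxx mul1r.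
by rewrite big1 ?addr0 // => i /negPf ->; rewrite mul0r.
Qed.

Lemma square_ideal_hpart j p : U p -> U (hpart 0 j p).
Proof.
move=> [c ->]; exists (fun i => hpart 2 j (c i)); rewrite hpart_sum.
apply: eq_bigr => -[v w] _ /=; apply: hpartM => m.
rewrite /xvar !mpolyXn => /msuppB_le; rewrite mem_cat !msuppX !inE.
by case/orP => /eqP ->; rewrite mdegMn mdeg1.
Qed.

(** A monomial multiple of a generator is a difference of two monomials with the same key. *)
Lemma square_ideal_coefsum p M0 : U p -> coefsum (fun M => key M == key M0) p = 0.
Proof.
move=> [c ->]; rewrite coefsum_sum big1 // => -[v w] _ /=.
rewrite {1}[c _]mpolyE mulr_suml coefsum_sum big1 // => M _.
rewrite -scalerAl coefsumZ /xvar !mpolyXn mulrBr -!mpolyXD coefsumB !coefsumX.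
suff -> : key (M + U_(enum_rank v) *+ 2) = key (M + U_(enum_rank w) *+ 2).
  by rewrite subrr mulr0.
congr pair; last by rewrite 2!mdegD 2!mdegMn 2!mdeg1.
by apply/setP => i; rewrite !inE 2!mnmDE 2!mulmnE 2!oddD 2!oddM /= !andbF.
Qed.

Definition odd_mon (M : vmon) : vmon := [multinom (odd (M i) : nat) | i < #|G|].

(** The representative of the class of [M] obtained by turning all squares into squares of the
    variable of [v0]. *)
Definition normal_mon (M : vmon) : vmon :=
  (odd_mon M + U_(enum_rank v0) *+ (2 * \sum_i (M i)./2))%MM.

Lemma mdeg_halves (M : vmon) :
  mdeg M = (mdeg (odd_mon M) + 2 * \sum_i (M i)./2)%N.
Proof.
rewrite !mdegE big_distrr -big_split; apply: eq_bigr => i _ /=.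
by rewrite mnmE mul2n odd_double_half.
Qed.

Lemma key_normal M : key (normal_mon M) = key M.
Proof.
congr pair; last by rewrite [RHS]mdeg_halves mdegD mdegMn mdeg1 mul1n.
apply/setP => i; rewrite !inE mnmDE mulmnE oddD !oddM andbF addbF mnmE.
by rewrite oddb.
Qed.

Lemma normal_key M1 M2 : key M1 = key M2 -> normal_mon M1 = normal_mon M2.
Proof.
case=> /setP e d.
have eo : odd_mon M1 = odd_mon M2.
  by apply/mnmP => i; rewrite !mnmE; have := e i; rewrite !inE => ->.
rewrite /normal_mon eo; congr (_ + _ *+ _)%MM; move: d.
by rewrite (mdeg_halves M1) (mdeg_halves M2) eo => /addnI.
Qed.

Lemma square_ideal_mulB p q p' q' : U (p - q) -> U (p' - q') -> U (p * p' - q * q').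
Proof.
move=> h h'; have -> : p * p' - q * q' = p * (p' - q') + q' * (p - q).
  by rewrite !mulrBr (mulrC q' p) (mulrC q' q) addrA subrK.
by apply: square_idealD; apply: square_idealM.
Qed.

Lemma square_ideal_expB p q k : U (p - q) -> U (p ^+ k - q ^+ k).
Proof.
move=> h; elim: k => [|k IHk]; first by rewrite subrr; apply: square_ideal0.
by rewrite !exprS; apply: square_ideal_mulB.
Qed.

Lemma square_ideal_normal M : U ('X_[M] - 'X_[normal_mon M]).
Proof.
have -> : 'X_[normal_mon M] =
    \prod_i ('X_i ^+ odd (M i) * (xvar K v0 ^+ 2) ^+ (M i)./2) :> R.
  rewrite big_split /= -expr_sum -exprM mpolyXD -mpolyXn; congr (_ * _).
  by rewrite mpolyXE_id; apply: eq_bigr => i _; rewrite mnmE.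
rewrite mpolyXE_id; apply: (big_ind2 (fun p q => U (p - q))).
- by rewrite subrr; apply: square_ideal0.
- by move=> p q p' q' h h'; apply: square_ideal_mulB.
move=> i _; rewrite -{1}(odd_double_half (M i)) exprD -mul2n exprM.
apply: square_ideal_mulB; first by rewrite subrr; apply: square_ideal0.
by apply: square_ideal_expB; rewrite -(enum_valK i); apply: square_ideal_gen.
Qed.

Lemma square_ideal_key M1 M2 : key M1 = key M2 -> U ('X_[M1] - 'X_[M2]).
Proof.
move=> /normal_key e.
have -> : 'X_[M1] - 'X_[M2] = ('X_[M1] - 'X_[normal_mon M1]) +
    (- 1) * ('X_[M2] - 'X_[normal_mon M2]) :> R.
  by rewrite mulN1r opprB e addrA subrK.
by apply: square_idealD; [|apply: square_idealM]; apply: square_ideal_normal.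
Qed.

(** Putting every monomial in normal form changes [p] only modulo the ideal, and the resulting
    coefficients are the class sums. *)
Lemma coefsum_square_ideal p :
  (forall M0, coefsum (fun M => key M == key M0) p = 0) -> U p.
Proof.
move=> h; have e0 : \sum_(M <- msupp p) p@_M *: 'X_[normal_mon M] = 0 :> R.
  apply/mpolyP => N; rewrite mcoeff0 raddf_sum /=.
  have [eN|nN] := eqVneq (normal_mon N) N.
    rewrite -[RHS](h N) coefsumE; apply: eq_bigr => M _; rewrite mcoeffZ mcoeffX.
    congr (_ * (nat_of_bool _)%:R); apply/eqP/eqP => [<-|/normal_key ->] //.
    by rewrite key_normal.
  rewrite big1 // => M _; rewrite mcoeffZ mcoeffX; case: eqP => [e|_].
    by case/eqP: nN; rewrite -e; apply: normal_key; rewrite key_normal.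
  by rewrite mulr0.
rewrite -(subr0 p) -e0 {1}[p]mpolyE -sumrB.
apply: (big_ind U) => [||M _]; [exact: square_ideal0 | exact: square_idealD |].
by rewrite -scalerBr -mul_mpolyC; apply: square_idealM; apply: square_ideal_normal.
Qed.

(** Translation by [N] is injective on keys, so class sums of [p] are class sums of the product. *)
Lemma square_ideal_nzd N p : U ('X_[N] * p) -> U p.
Proof.
move=> h; apply: coefsum_square_ideal => M0; rewrite -[RHS](square_ideal_coefsum (N + M0)%MM h).
rewrite coefsumE {3}[p]mpolyE mulr_sumr coefsum_sum; apply: eq_bigr => M _.
by rewrite -scalerAr -mpolyXD coefsumZ coefsumX key_addl.
Qed.

(** * The map [theta] on monomials *)

Definition vmon_of (m : emon) : vmon :=
  (\sum_(k < #|edges G|) (\sum_(v in enum_val k) U_(enum_rank v)) *+ m k)%MM.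

Lemma thetaX m : theta ('X_[m] : {mpoly K[#|edges G|]}) = 'X_[vmon_of m].
Proof.
rewrite /theta comp_mpolyX /vmon_of.
rewrite (big_morph (fun M : vmon => 'X_[M] : R) (@mpolyXD _ _) (@mpolyX0 _ _)).
apply: eq_bigr => k _; rewrite tnth_mktuple -mpolyXn; congr (_ ^+ _).
by rewrite (big_morph (fun M : vmon => 'X_[M] : R) (@mpolyXD _ _) (@mpolyX0 _ _)).
Qed.

Lemma card_edge (k : 'I_#|edges G|) : #|enum_val k| = 2%N.
Proof.
have /imsetP[[a b] /=] := enum_valP k; rewrite inE /= => ab ->.
by rewrite cards2; case: eqP ab => // ->; rewrite adj_irrefl.
Qed.

Lemma mdeg_vmon_of m : mdeg (vmon_of m) = (mdeg m).*2.
Proof.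
rewrite /vmon_of mdeg_sum [mdeg m]mdegE -muln2 big_distrl /=.
apply: eq_bigr => k _; rewrite mdegMn mdeg_sum mulnC; congr (_ * _)%N.
by under eq_bigr do rewrite mdeg1; rewrite sum1_card card_edge.
Qed.

Lemma vmon_of_boundary m i :
  odd (vmon_of m i) = (enum_val i \in boundary m).
Proof.
rewrite inE mnm_sumE; congr odd; apply: eq_bigr => k _; rewrite mulmnE.
congr (_ * _)%N; rewrite mnm_sumE; have [vk|vk] := boolP (enum_val i \in _).
  rewrite (bigD1 (enum_val i)) //= mnm1E enum_valK eqxx big1 // => v /andP[_ nv].
  by rewrite mnm1E -(inj_eq enum_val_inj) enum_rankK (negPf nv).
rewrite big1 // => v ve; rewrite mnm1E -(inj_eq enum_val_inj) enum_rankK.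
by case: eqP vk => // <-; rewrite ve.
Qed.

Lemma key_vmon_of m1 m2 : key (vmon_of m1) = key (vmon_of m2) <->
  boundary m1 = boundary m2 /\ mdeg m1 = mdeg m2.
Proof.
split=> [[/setP e d]|[e d]]; last first.
  rewrite /key !mdeg_vmon_of d; congr pair; apply/setP => i.
  by rewrite in_set [RHS]in_set !vmon_of_boundary e.
split; last by apply: double_inj; rewrite -!mdeg_vmon_of.
apply/setP => v; have := e (enum_rank v).
by rewrite in_set [X in _ = X -> _]in_set !vmon_of_boundary enum_rankK.
Qed.

Local Notation I := (@IX K G).
Local Notation S := {mpoly K[#|edges G|]}.

Let thetaD (p q : S) : theta (p + q) = theta p + theta q.
Proof. exact: comp_mpolyD. Qed.

Let thetaB (p q : S) : theta (p - q) = theta p - theta q.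
Proof. exact: comp_mpolyB. Qed.

Let thetaM (p q : S) : theta (p * q) = theta p * theta q.
Proof. exact: rmorphM. Qed.

Let thetaE (p : S) : theta p = \sum_(m <- msupp p) p@_m *: 'X_[vmon_of m].
Proof.
by rewrite /theta comp_mpolyEX; apply: eq_bigr => m _; rewrite -thetaX.
Qed.

Lemma theta_hpart j (p : S) : theta (hpart 0 j p) = hpart 0 j.*2 (theta p).
Proof.
rewrite [theta p]thetaE hpart_sum [hpart 0 j p]/hpart /mpart /theta linear_sum big_mkcond /=.
apply: eq_bigr => m _; rewrite linearZ /= -[_ \mPo _]/(theta _) thetaX.
apply/mpolyP => M; rewrite [RHS]mcoeff_hpart [in LHS]fun_if mcoeff0.
rewrite mcoeffZ mcoeffX; case: (vmon_of m =P M) => [<-|_].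
  by rewrite mdeg_vmon_of !addn0 (inj_eq double_inj).
by rewrite mulr0 !if_same.
Qed.

Lemma IX0 : I 0.
Proof. by rewrite /IX /theta comp_mpoly0; apply: square_ideal0. Qed.

Lemma IXD p q : I p -> I q -> I (p + q).
Proof. by rewrite /IX thetaD; apply: square_idealD. Qed.

Lemma IXM p q : I q -> I (p * q).
Proof. by rewrite /IX thetaM; apply: square_idealM. Qed.

Lemma IX_boundary m1 m2 : boundary m1 = boundary m2 -> mdeg m1 = mdeg m2 ->
  I ('X_[m1] - 'X_[m2]).
Proof.
move=> e d; rewrite /IX thetaB !thetaX; apply: square_ideal_key.
by apply/key_vmon_of.
Qed.

(** No monomial of ['X_k * g] shares the class of [m], so the sum over that class is 1 instead of
    0. *)
Lemma IX_not_monomial m k (g : S) :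
  (forall m', boundary (U_(k) + m') = boundary m ->
     mdeg (U_(k) + m') <> mdeg m) ->
  ~ I ('X_[m] - 'X_k * g).
Proof.
move=> hm /(square_ideal_coefsum (vmon_of m)); rewrite thetaB thetaX coefsumB coefsumX eqxx.
rewrite [g]mpolyE mulr_sumr /theta linear_sum coefsum_sum big1.
  by rewrite subr0 => /eqP; rewrite oner_eq0.
move=> m' _; rewrite -scalerAr -mpolyXD linearZ /= -[_ \mPo _]/(theta _) thetaX.
rewrite coefsumZ coefsumX; case: eqP => [/key_vmon_of[/hm]//|_].
by rewrite mulr0.
Qed.

(** * Top degree modulo [I(X_G)] and one edge variable *)

Hypothesis bipG : bipartite G.
Local Notation mu := (max_vertex_join_number G).

Lemma boundary_addl (m m1 m2 : emon) : boundary m1 = boundary m2 ->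
  boundary (m + m1) = boundary (m + m2).
Proof. by move=> e; apply/setP => v; rewrite !boundaryD e. Qed.

Lemma boundary_add2 (m m' : emon) : boundary (m' + (m' + m)) = boundary m.
Proof. by apply/setP => v; rewrite !boundaryD addKb. Qed.

Lemma odd_gap a b : odd a = ~~ odd b -> (a < b)%N ->
  exists t, (b = 1 + (a + t.*2))%N.
Proof.
move=> par ab; exists (b - a)./2.
by have := odd_double_half (b - a); rewrite oddB ?(ltnW ab) // par addbN addbb; lia.
Qed.

Lemma IX_above k j (f : S) : (mu <= j)%N -> hpart 0 j f = f ->
  exists g, I (f - 'X_k * g).
Proof.
move=> muj <-; rewrite /hpart /mpart.
pose Q p := exists g, I (p - 'X_k * g).
apply: (big_ind Q) => [|p q [g hg] [h hh]|m].
- by exists 0; rewrite mulr0 subr0; apply: IX0.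
- exists (g + h); rewrite mulrDr opprD addrACA; exact: IXD.
rewrite addn0 => /eqP mj.
suff [g hg] : Q 'X_[m].
  exists (f@_m *: g); rewrite -scalerAr -scalerBr -mul_mpolyC; exact: IXM.
have [m' em' m'mu] := boundary_short (U_(k) + m)%MM.
have := boundary_parity bipG em'; rewrite mdegD mdeg1 mj => par.
(* Bipartiteness gives [mdeg m'] the parity of [j + 1], so it cannot equal [j]. *)
have lt_m'j : (mdeg m' < j)%N.
  rewrite ltn_neqAle (leq_trans m'mu muj) andbT; apply/eqP => e.
  by move: par; rewrite e /=; case: (odd j).
have [t et] := odd_gap par lt_m'j.
(* An even power of ['X_k] fills the degree without changing the boundary; the factor ['X_k] then
   restores that of [m]. *)
exists 'X_[m' + U_(k) *+ t.*2]; rewrite -mpolyXD; apply: IX_boundary.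
  apply/setP => v; rewrite !boundaryD em' boundaryD.
  have -> : (v \in boundary (U_(k) *+ t.*2)) = false.
    rewrite inE (big_morph odd oddD (erefl _)) big1 // => i _.
    by rewrite mulmnE mulnA oddM odd_double andbF.
  by rewrite addbF addbA addbb addFb.
by rewrite !mdegD mdegMn !mdeg1 mj mul1n -et.
Qed.

(** Adding edge [k] to a longest minimal monomial [m] gives a boundary whose short representative
    [m'] has degree below [mu] by parity, and at least [mu - 1] by minimality of [m]. *)
Lemma IX_top k : (0 < mu)%N /\ exists2 f : S, hpart 0 mu.-1 f = f &
  forall g, ~ I (f - 'X_k * g).
Proof.
have [m emu minm] := boundary_long G.
have [m' em' m'mu] := boundary_short (U_(k) + m)%MM.
have par := boundary_parity bipG em'; rewrite mdegD mdeg1 emu in par.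
have m'_lt : (mdeg m' < mu)%N.
  rewrite ltn_neqAle m'mu andbT; apply/eqP => e.
  by move: par; rewrite e /=; case: (odd _).
have ekm' : boundary (U_(k) + m') = boundary m.
  by rewrite (boundary_addl _ em') boundary_add2.
have := minm _ ekm'; rewrite emu mdegD mdeg1 => mu_le.
have em'mu : mdeg m' = mu.-1 by lia.
split; first by lia.
exists 'X_[m'].
  apply/mpolyP => M; rewrite mcoeff_hpart mcoeffX.
  by case: (m' =P M) => [<-|_]; rewrite ?if_same // addn0 em'mu eqxx.
(* A monomial [m2] with ['X_k] times it congruent to [m'] would have the boundary of [m] in degree
   [mu - 2]. *)
move=> g; apply: IX_not_monomial => m2 e2; rewrite em'mu mdegD mdeg1 => d2.
have := minm m2; rewrite emu -ekm' -(boundary_addl _ e2) boundary_add2.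
by move=> /(_ (erefl _)); lia.
Qed.

Lemma IX_top_degree (k : 'I_#|edges G|) : top_degree_ideal k mu.-1 I.
Proof.
have [mu_gt0 top] := IX_top k; split=> //.
- exact: IX0.
- exact: IXD.
- exact: IXM.
- by move=> j f; rewrite /IX theta_hpart; apply: square_ideal_hpart.
- by move=> f; rewrite /IX thetaM thetaX; apply: square_ideal_nzd.
by move=> j f; rewrite prednK //; apply: IX_above.
Qed.

End SquareIdeal.

Theorem theorem4p5 (K : fieldType) (G : sgraph) (hV : (0 < #|G|)%N)
    (hiso : no_isolated_vertices G) (hbip : bipartite G) :
  ideal_regularity (@IX K G) (max_vertex_join_number G)%:Z.
Proof.
(* A vertex and a neighbour supply the edge variable used for the reduction. *)
have [v0 _] := card_gt0P hV; have [w vw] := hiso v0.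
have eE : [set v0; w] \in edges G by apply/imsetP; exists (v0, w); rewrite ?inE.
pose k := enum_rank_in eE [set v0; w].
have [mu_gt0 _] := IX_top K hbip k.
exists (max_vertex_join_number G).-1%:Z.
  exact: quotient_regularity_top_degree (IX_top_degree K v0 hbip k).
by rewrite -PoszD addn1 prednK.
Qed.
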